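(* The algorithm OPT (described in the context) outputs a regimen minimizing the expected completion time for the ROPAS problem, and it runs in time polynomial in the input size whenever the width of the dag $\mathcal{G}$ is bounded by a constant and the number $n$ of workers is also bounded by a constant.
   Context: ROPAS problem: A dag $\mathcal{G}$ with tasks $\{1,\ldots,t\}$ is given, together with $n$ workers, where worker $i$ executes task $j$ successfully with probability $0\le p_{i,j}\le 1$, and for every task $j$ some worker $i$ has $p_{i,j}>0$. A set of tasks satisfies precedence constraints if it contains every parent of each of its tasks; for such a set $X$, $E(X)$ denotes the set of tasks not in $X$ all of whose parents are in $X$ (eligible tasks). Execution proceeds in rounds starting from the set $Y=\emptyset$ of executed tasks: a regimen $\Sigma$ maps each set $Y$ satisfying precedence constraints to an assignment $\Sigma(Y)$ sending each worker either to a task of $E(Y)$ or to idle (several workers may be assigned to the same task). Each assigned worker independently succeeds with the corresponding probability; a task is executed in the round iff at least one worker assigned to it succeeds, and executed tasks are added to $Y$. The game ends when all sinks of $\mathcal{G}$ are in $Y$. The goal is a regimen minimizing the expected number of rounds (completion time). The width of a dag is the maximum cardinality of an antichain (a set of pairwise incomparable nodes). Algorithm OPT: Build the admissible evolution of execution $\mathcal{A}$, the dag whose nodes are all task sets satisfying precedence constraints, with an arc from $X$ to $X\cup D$ for every nonempty $D\subseteq E(X)$; it has single source $\emptyset$ and single sink equal to the whole task set. Take a topological sort $Y_1,\ldots,Y_m$ of $\mathcal{A}$, set $S_{Y_m}=0$, and for $h=m-1$ down to $1$: for every assignment $A$ of all $n$ workers to tasks of $E(Y_h)$ (no idling), compute,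 for each nonempty set $D$ of assigned tasks, the probability $a_D$ that exactly the tasks of $D$ get executed under $A$, and the probability $a$ that every assigned worker fails; evaluate $(1+\sum_D a_D S_{Y_h\cup D})/(1-a)$; set $S_{Y_h}$ to the minimum of this value over all assignments and $\Sigma_{OPT}(Y_h)$ to a minimizing assignment. (It has been established that this regimen $\Sigma_{OPT}$ minimizes the expected completion time.) *)

(* Defs.v *)
From mathcomp Require Import all_boot all_order all_algebra.

Set Implicit Arguments.
Unset Strict Implicit.
Unset Printing Implicit Defensive.

Import Order.TTheory GRing.Theory Num.Theory.

Local Open Scope ring_scope.

(** * ROPAS instances *)

Record ropas (F : realFieldType) := Ropas {
  ntasks : nat;
  nworkers : nat;
  arc : rel 'I_ntasks;
  prob : 'I_nworkers -> 'I_ntasks -> F;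
  arc_acyclic : forall c : seq 'I_ntasks, cycle arc c -> c = [::];
  prob_bounds : forall i j, 0 <= prob i j <= 1;
  prob_cover : forall j, exists i, 0 < prob i j
}.

Section Instance.
Context {F : realFieldType} (I : ropas F).

Definition closed_set (X : {set 'I_(ntasks I)}) : bool :=
  [forall j in X, forall i, arc i j ==> (i \in X)].

Definition eligible (X : {set 'I_(ntasks I)}) : {set 'I_(ntasks I)} :=
  [set j | (j \notin X) && [forall i, arc i j ==> (i \in X)]].

Definition is_sink (j : 'I_(ntasks I)) : bool := [forall k, ~~ arc j k].

Definition completed (X : {set 'I_(ntasks I)}) : bool :=
  [forall j, is_sink j ==> (j \in X)].

(* [connect] is the reflexive-transitive closure, i.e. reachability in the
   dag; both orientations of each pair are covered. *)
Definition antichain (X : {set 'I_(ntasks I)}) : bool :=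
  [forall x in X, forall y in X, (x != y) ==> ~~ connect (@arc F I) x y].

Definition width : nat :=
  \max_(X : {set 'I_(ntasks I)} | antichain X) #|X|.

(* [None] is idling. *)
Definition assignment := {ffun 'I_(nworkers I) -> option 'I_(ntasks I)}.

Definition regimen := {set 'I_(ntasks I)} -> assignment.

(* Values outside the sets satisfying the precedence constraints are junk. *)
Definition is_regimen (S : regimen) : Prop :=
  forall Y, closed_set Y ->
    forall i j, S Y i = Some j -> j \in eligible Y.

(** * The random execution under a regimen *)

Definition success_prob (A : assignment) (i : 'I_(nworkers I)) : F :=
  if A i is Some j then prob i j else 0.

(* [w i] tells whether worker [i] succeeds in the round; the workers are
   independent. *)
Definition outcome_prob (A : assignment)
    (w : {ffun 'I_(nworkers I) -> bool}) : F :=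
  \prod_i (if w i then success_prob A i else 1 - success_prob A i).

Definition executed (A : assignment) (w : {ffun 'I_(nworkers I) -> bool}) :
    {set 'I_(ntasks I)} :=
  [set j | [exists i, w i && (A i == Some j)]].

Definition round_prob (S : regimen) (Y Z : {set 'I_(ntasks I)}) : F :=
  \sum_(w | Y :|: executed (S Y) w == Z) outcome_prob (S Y) w.

(* [law S k Y] is the probability that the set of executed tasks after [k]
   rounds is [Y]. *)
Fixpoint law (S : regimen) (k : nat) (Z : {set 'I_(ntasks I)}) : F :=
  if k is k'.+1 then \sum_Y law S k' Y * round_prob S Y Z
  else (Z == set0)%:R.

(* The probability that the game lasts exactly [k] rounds, i.e. that the
   executed set is completed after [k] rounds and not before; executed sets
   only grow, so it suffices to look at the round just before. *)
Definition completion_prob (S : regimen) (k : nat) : F :=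
  if k is k'.+1 then
    \sum_(Y | ~~ completed Y) \sum_(Z | completed Z)
       law S k' Y * round_prob S Y Z
  else (completed set0)%:R.

End Instance.

(** * Programs with a step count

  A program returns its result together with the number of steps it took.
  Random access to an input entry (arc or probability), to a bit of a bit
  vector, or to a list cell is one step; a task set is a bit vector of length
  [ntasks I], and whole-vector operations cost that length. *)

Definition prog (A : Type) : Type := (A * nat)%type.

Definition ret {A : Type} (a : A) : prog A := (a, 0%N).
Definition charge {A : Type} (k : nat) (a : A) : prog A := (a, k).
Definition bind {A B : Type} (m : prog A) (f : A -> prog B) : prog B :=
  ((f m.1).1, (m.2 + (f m.1).2)%N).

Notation "'let!' x ':=' m 'in' f" := (bind m (fun x => f))
  (at level 200, x name, m at level 100, f at level 200,
   format "'[v' 'let!'  x  ':='  m  'in' '/' f ']'").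

Definition result {A : Type} (m : prog A) : A := m.1.
Definition steps {A : Type} (m : prog A) : nat := m.2.

Fixpoint foldM {A B : Type} (f : B -> A -> prog B) (b : B) (s : seq A) :
    prog B :=
  if s is x :: s' then
    let! _ := charge 1 tt in
    let! b' := f b x in
    foldM f b' s'
  else ret b.

Fixpoint mapM {A B : Type} (f : A -> prog B) (s : seq A) : prog (seq B) :=
  if s is x :: s' then
    let! _ := charge 1 tt in
    let! y := f x in
    let! r := mapM f s' in
    ret (y :: r)
  else ret [::].

Fixpoint filterM {A : Type} (f : A -> prog bool) (s : seq A) : prog (seq A) :=
  if s is x :: s' then
    let! _ := charge 1 tt in
    let! b := f x in
    let! r := filterM f s' in
    ret (if b then x :: r else r)
  else ret [::].

Fixpoint findM {A : Type} (f : A -> prog bool) (s : seq A) :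
    prog (option A) :=
  if s is x :: s' then
    let! _ := charge 1 tt in
    let! b := f x in
    if b then ret (Some x) else findM f s'
  else ret None.

Definition catM {A : Type} (s1 s2 : seq A) : prog (seq A) :=
  charge (size s1).+1 (s1 ++ s2).

Definition flatmapM {A B : Type} (f : A -> prog (seq B)) (s : seq A) :
    prog (seq B) :=
  foldM (fun acc x => let! r := f x in catM r acc) [::] s.

Definition allM {A : Type} (f : A -> prog bool) (s : seq A) : prog bool :=
  foldM (fun b x => let! c := f x in ret (b && c)) true s.

Definition hasM {A : Type} (f : A -> prog bool) (s : seq A) : prog bool :=
  foldM (fun b x => let! c := f x in ret (b || c)) false s.

(** * Algorithm OPT

  [cost x y] is the number of steps of one arithmetic operation or comparison
  on the operands [x] and [y]. *)

Section Opt.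
Context {F : realFieldType} (cost : F -> F -> nat) (I : ropas F).

Local Notation task := 'I_(ntasks I).
Local Notation worker := 'I_(nworkers I).
Local Notation t := (ntasks I).

Definition addM (x y : F) : prog F := charge (cost x y) (x + y).
Definition subM (x y : F) : prog F := charge (cost x y) (x - y).
Definition mulM (x y : F) : prog F := charge (cost x y) (x * y).
Definition divM (x y : F) : prog F := charge (cost x y) (x / y).
Definition ltM (x y : F) : prog bool := charge (cost x y) (x < y).
Definition eqM (x y : F) : prog bool := charge (cost x y) (x == y).
Definition probM (i : worker) (j : task) : prog F := charge 1 (prob i j).

Definition in_setM (j : task) (X : {set task}) : prog bool :=
  charge 1 (j \in X).
Definition eq_setM (X Y : {set task}) : prog bool := charge t (X == Y).
Definition unionM (X Y : {set task}) : prog {set task} := charge t (X :|: Y).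
Definition add_taskM (j : task) (X : {set task}) : prog {set task} :=
  charge t (j |: X).
Definition nonemptyM (X : {set task}) : prog bool := charge t (X != set0).

Definition memM (X : {set task}) (s : seq {set task}) : prog bool :=
  hasM (eq_setM X) s.

Fixpoint subsetsM (s : seq task) : prog (seq {set task}) :=
  if s is j :: s' then
    let! r := subsetsM s' in
    let! r' := mapM (add_taskM j) r in
    catM r' r
  else charge t [:: set0].

Definition nonempty_subsetsM (s : seq task) : prog (seq {set task}) :=
  let! r := subsetsM s in
  filterM nonemptyM r.

(* The list of the tasks of E(X). *)
Definition eligibleM (X : {set task}) : prog (seq task) :=
  filterM (fun j =>
    let! inX := in_setM j X in
    let! parents := allM (fun i =>
      let! e := charge 1 (arc i j) in
      let! iX := in_setM i X in
      ret (e ==> iX)) (enum 'I_t) in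
    ret (~~ inX && parents)) (enum 'I_t).

Definition successorsM (X : {set task}) : prog (seq {set task}) :=
  let! E := eligibleM X in
  let! Ds := nonempty_subsetsM E in
  mapM (unionM X) Ds.

Definition insertM (nodes : seq {set task}) (X : {set task}) :
    prog (seq {set task}) :=
  let! b := memM X nodes in
  ret (if b then nodes else X :: nodes).

(* The nodes of the admissible evolution: saturate the set of the empty set
   under successors; [t] passes suffice as an arc adds at least one task. *)
Definition evolution_nodesM : prog (seq {set task}) :=
  let! start := charge t [:: set0] in
  foldM (fun nodes _ =>
    let! new := flatmapM successorsM nodes in
    foldM insertM nodes new) start (enum 'I_t).

Definition evolution_arcsM (nodes : seq {set task}) :
    prog (seq ({set task} * {set task})) :=
  flatmapM (fun X =>
    let! r := successorsM X in
    mapM (fun Z => ret (X, Z)) r) nodes.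

(* Topological sort: repeatedly output a node without incoming arc from the
   remaining nodes. *)
Fixpoint toposortM (fuel : nat) (arcs : seq ({set task} * {set task}))
    (nodes : seq {set task}) : prog (seq {set task}) :=
  if fuel is fuel'.+1 then
    let! src := findM (fun X =>
      let! b := hasM (fun a : {set task} * {set task} =>
        let! hd := eq_setM a.2 X in
        let! tl := memM a.1 nodes in
        ret (hd && tl)) arcs in
      ret (~~ b)) nodes in
    if src is Some X then
      let! nodes' := filterM (fun Z =>
        let! b := eq_setM Z X in ret (~~ b)) nodes in
      let! r := toposortM fuel' arcs nodes' in
      charge 1 (X :: r)
    else ret [::]
  else ret [::].

(* A nonidling assignment is the list of its (worker, task) pairs. *)
Fixpoint assignmentsM (ws : seq worker) (E : seq task) :
    prog (seq (seq (worker * task))) :=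
  if ws is i :: ws' then
    let! r := assignmentsM ws' E in
    flatmapM (fun A => mapM (fun j => charge 1 ((i, j) :: A)) E) r
  else charge 1 [:: [::]].

Definition assigned_tasksM (E : seq task) (A : seq (worker * task)) :
    prog (seq task) :=
  filterM (fun j =>
    hasM (fun ij : worker * task => charge 1 (ij.2 == j)) A) E.

(* The probability that every worker assigned to [j] fails. *)
Definition task_failM (A : seq (worker * task)) (j : task) : prog F :=
  foldM (fun acc (ij : worker * task) =>
    let! b := charge 1 (ij.2 == j) in
    if b then
      let! p := probM ij.1 ij.2 in
      let! q := subM 1 p in
      mulM acc q
    else ret acc) 1 A.

(* The probability a that every assigned worker fails. *)
Definition all_failM (A : seq (worker * task)) : prog F :=
  foldM (fun acc (ij : worker * task) =>
    let! p := probM ij.1 ij.2 in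
    let! q := subM 1 p in
    mulM acc q) 1 A.

(* The probability a_D that, among the assigned tasks [U], exactly those of
   [D] get executed. *)
Definition exactlyM (A : seq (worker * task)) (U : seq task) (D : {set task}) :
    prog F :=
  foldM (fun acc j =>
    let! f := task_failM A j in
    let! jD := in_setM j D in
    if jD then
      let! s := subM 1 f in
      mulM acc s
    else mulM acc f) 1 U.

Definition entry : Type := ({set task} * (F * seq (worker * task)))%type.

(* The value S_X recorded in the table. *)
Definition lookupM (table : seq entry) (X : {set task}) : prog F :=
  let! r := findM (fun e : entry => eq_setM e.1 X) table in
  ret (if r is Some e then e.2.1 else 0).

(* The value (1 + sum_D a_D S_(Y u D)) / (1 - a) of an assignment; [None]
   stands for the value +oo, obtained when a = 1. *)
Definition evaluateM (table : seq entry) (Y : {set task}) (E : seq task)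
    (A : seq (worker * task)) : prog (option F) :=
  let! a := all_failM A in
  let! d := subM 1 a in
  let! infinite := eqM d 0 in
  if infinite then ret None else
  let! U := assigned_tasksM E A in
  let! Ds := nonempty_subsetsM U in
  let! s := foldM (fun acc D =>
    let! aD := exactlyM A U D in
    let! Z := unionM Y D in
    let! SZ := lookupM table Z in
    let! x := mulM aD SZ in
    addM acc x) 1 Ds in
  let! v := divM s d in
  ret (Some v).

Definition minimizeM (table : seq entry) (Y : {set task}) (E : seq task)
    (As : seq (seq (worker * task))) :
    prog (option (F * seq (worker * task))) :=
  foldM (fun best A =>
    let! v := evaluateM table Y E A in
    match v, best with
    | None, _ => ret best
    | Some x, None => ret (Some (x, A))
    | Some x, Some (y, B) =>
        let! b := ltM x y in
        ret (if b then Some (x, A) else Some (y, B))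
    end) None As.

Definition entryM (table : seq entry) (Y : {set task}) : prog entry :=
  let! E := eligibleM Y in
  let! As := assignmentsM (enum 'I_(nworkers I)) E in
  let! best := minimizeM table Y E As in
  ret (Y, if best is Some vA then vA else (0, [::])).

(* Processes a topological sort backwards from its last node. *)
Fixpoint tableM (order : seq {set task}) : prog (seq entry) :=
  match order with
  | [::] => ret [::]
  | [:: Y] => charge 1 [:: (Y, (0, [::]))]
  | Y :: order' =>
      let! table := tableM order' in
      let! e := entryM table Y in
      charge 1 (e :: table)
  end.

Definition optM : prog (seq entry) :=
  let! nodes := evolution_nodesM in
  let! arcs := evolution_arcsM nodes in
  let! m := charge (size nodes) (size nodes) in
  let! order := toposortM m arcs nodes in
  tableM order.

Definition assignment_of (A : seq (worker * task)) : assignment I :=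
  [ffun i => omap snd (ohead [seq ij <- A | ij.1 == i])].

(* The regimen described by the table that OPT outputs. *)
Definition opt_regimen : regimen I := fun Y =>
  if [seq e <- result optM | e.1 == Y] is e :: _ then assignment_of e.2.2
  else [ffun=> None].

Definition opt_time : nat := steps optM.

End Opt.

Arguments opt_regimen {F} cost I Y.

(** * Running time

  [bits x] is the length of the representation of the number [x]. *)

(* The adjacency matrix and the matrix of success probabilities. *)
Definition input_size (F : realFieldType) (bits : F -> nat) (I : ropas F) :
    nat :=
  (ntasks I * ntasks I + \sum_i \sum_j bits (@prob _ I i j))%N.

(* [c] and [d] depend on the bounds on the width and on the number of workers
   only. *)
Definition opt_polynomial_time (F : realFieldType) (cost : F -> F -> nat)
    (bits : F -> nat) : Prop :=
  forall width_bound worker_bound : nat, exists c d : nat,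
  forall I : ropas F,
    (width I <= width_bound)%N -> (nworkers I <= worker_bound)%N ->
    (opt_time cost I <= c * input_size bits I ^ d + c)%N.

(* Real RAM: a number fits in one cell, an operation is one step. *)
Definition unit_bits (F : realFieldType) (x : F) : nat := 1%N.
Definition unit_cost (F : realFieldType) (x y : F) : nat := 1%N.

(* Bit complexity over the rationals: numerator and denominator of the reduced
   fraction are in binary, with a sign bit, and an operation (schoolbook
   arithmetic followed by Euclid's algorithm) takes quadratic time. *)
Definition nat_bits (n : nat) : nat := (trunc_log 2 n).+1.
Definition rat_bits (x : rat) : nat :=
  (nat_bits `|numq x| + nat_bits `|denq x| + 1)%N.
Definition bit_cost (x y : rat) : nat := ((rat_bits x + rat_bits y) ^ 2)%N.

Section Ratr.
Context (F : realFieldType) (I : ropas rat).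

Fact ratr_prob_bounds i j : 0 <= (ratr (@prob _ I i j) : F) <= 1.
Proof. by rewrite ler0q -(rmorph1 (@ratr F)) ler_rat prob_bounds. Qed.

Fact ratr_prob_cover j : exists i, 0 < (ratr (@prob _ I i j) : F).
Proof. by have [i pi] := prob_cover j; exists i; rewrite ltr0q. Qed.

Definition ropas_ratr : ropas F :=
  Ropas (@arc_acyclic _ I) ratr_prob_bounds ratr_prob_cover.

End Ratr.

From mathcomp Require Import reals ereal topology normedtype sequences.

(** * Expected completion time *)

Section Expectation.
Context {R : realType} (I : ropas R).
Local Open Scope ereal_scope.

(* The second summand is the contribution +oo * P(T = +oo) of the executions
   that never end (with +oo * 0 = 0). *)
Definition expected_time (S : regimen I) : \bar R :=
  \sum_(0 <= k <oo) (k%:R * completion_prob S k)%:E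
  + +oo * (1 - \sum_(0 <= k <oo) (completion_prob S k)%:E).

Definition optimal (S : regimen I) : Prop :=
  is_regimen S /\
  forall S' : regimen I, is_regimen S' -> expected_time S <= expected_time S'.

End Expectation.

Arguments optimal {R} I S.

(* Main.v *)
(** Optimality. The values [V] computed by OPT satisfy the Bellman equations
    over nonidling assignments. Coupling all assignments on one probability
    space (each worker tosses a coin for each task) shows by induction that [V]
    is nonincreasing in the set of executed tasks, so that idling workers can be
    put to work without loss and the Bellman inequality holds for every
    assignment. Iterating it along the execution of a regimen bounds [V set0] by
    the sum of the probabilities that the game is not over after [k] rounds,
    which is the expected completion time; for OPT all of these are equalities.

    Running time. A set satisfying the precedence constraints is determined by
    the antichain of its maximal elements, and a set of eligible tasks is an
    antichain, so bounded width leaves polynomially many nodes, of bounded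
    out-degree. Over the rationals, each new entry of the table multiplies the
    common denominator of the entries by a factor with polynomially many bits;
    as there are polynomially many entries, all numbers stay of polynomial
    length. *)

From mathcomp Require Import all_boot all_order all_algebra.
From mathcomp Require Import zify ring lra.
From mathcomp Require Import reals.
Require Import Defs.

Set Implicit Arguments.
Unset Strict Implicit.
Unset Printing Implicit Defensive.

Import Order.TTheory GRing.Theory Num.Theory.

Local Open Scope ring_scope.

(** * Programs with a step count *)

(** Two obstacles shape the optimality proof. When [V] is compared on [Y \subset Y'], both coupled
    games may stand still in a round, and then no induction hypothesis applies; that event is kept
    aside as a multiple of the difference itself, with a factor below 1. Moreover a competing
    regimen may never finish: iterating the Bellman inequality leaves a remainder of the order of
    the survival probability, which either vanishes in the limit or goes with an infinite expected
    time. The running time is proved once for an abstract notion of size, with the unit-cost and the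
    bit model as instances. Sizes are compared by divisibility, so that a whole table can be kept at
    one common size; tracking each number separately could make bit lengths grow exponentially along
    the table. Over the rationals, only the Bellman equations, which are finite, are carried over to
    the reals, where the expectation lives. *)

Lemma result_foldM {A B : Type} (f : B -> A -> prog B) b (s : seq A) :
  result (foldM f b s) = foldl (fun b x => result (f b x)) b s.
Proof. by elim: s b => //= x s IH b; rewrite -IH. Qed.

Section Combinators.
Context {A B : Type}.
Implicit Types (s : seq A).

Lemma result_mapM (f : A -> prog B) s :
  result (mapM f s) = [seq result (f x) | x <- s].
Proof. by elim: s => //= x s <-. Qed.

Lemma result_filterM (f : A -> prog bool) s :
  result (filterM f s) = [seq x <- s | result (f x)].
Proof. by elim: s => //= x s <-. Qed.

Lemma result_findM (f : A -> prog bool) s :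
  result (findM f s) = ohead [seq x <- s | result (f x)].
Proof.
elim: s => //= x s IH; rewrite /result /= in IH *.
by case: (f x).1.
Qed.

Lemma result_allM (f : A -> prog bool) s :
  result (allM f s) = all (fun x => result (f x)) s.
Proof.
rewrite /allM result_foldM /result /=.
have aux b : foldl (fun b x => b && (f x).1) b s = b && all (fun x => (f x).1) s.
  by elim: s b => [|x s IH] b /=; rewrite ?andbT // IH andbA.
by rewrite aux.
Qed.

Lemma result_hasM (f : A -> prog bool) s :
  result (hasM f s) = has (fun x => result (f x)) s.
Proof.
rewrite /hasM result_foldM /result /=.
have aux b : foldl (fun b x => b || (f x).1) b s = b || has (fun x => (f x).1) s.
  by elim: s b => [|x s IH] b /=; rewrite ?orbF // IH orbA.
by rewrite aux.
Qed.

End Combinators.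

Section FlatMap.
Context {A : Type} {B : eqType}.
Implicit Types (s : seq A).

Lemma result_flatmapM (f : A -> prog (seq B)) s y :
  (y \in result (flatmapM f s)) = has (fun x => y \in result (f x)) s.
Proof.
rewrite /flatmapM result_foldM /result /=.
have aux acc : (y \in foldl (fun acc x => (f x).1 ++ acc) acc s)
    = (y \in acc) || has (fun x => y \in (f x).1) s.
  elim: s acc => [|x s IH] acc /=; first by rewrite orbF.
  by rewrite IH mem_cat orbAC -orbA orbC -orbA orbC -orbA.
by rewrite aux in_nil.
Qed.

End FlatMap.

Section Steps.
Context {A : eqType} {B : Type}.
Implicit Types (s : seq A).
Local Open Scope nat_scope.

Lemma foldM_inv (P : nat -> B -> Prop) (f : B -> A -> prog B) b s k m :
  P m b ->
  (forall i b x, m <= i < m + size s -> x \in s -> P i b ->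
     P i.+1 (result (f b x)) /\ steps (f b x) <= k) ->
  P (m + size s) (result (foldM f b s)) /\ steps (foldM f b s) <= size s * k.+1.
Proof.
elim: s b m => [|x s IH] b m Pb H /=; first by rewrite addn0.
have [|Pfb stf] := H m b x _ (mem_head _ _) Pb.
  by rewrite leqnn /= -addSnnS leq_addr.
have [|P' st'] := IH _ m.+1 Pfb.
  move=> i c y /andP[mi ims] ys; apply: H; last by rewrite inE ys orbT.
  by rewrite ltnW //= -addSnnS.
rewrite -addSnnS; split=> //.
by rewrite /steps /bind /= in stf st' *; rewrite mulSn !addSn add0n ltnS leq_add.
Qed.

Lemma foldM_result_ind (P : B -> Prop) (f : B -> A -> prog B) b s :
  P b -> (forall b x, x \in s -> P b -> P (result (f b x))) ->
  P (result (foldM f b s)).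
Proof.
elim: s b => //= x s IH b Pb H; apply: IH; first exact: H (mem_head _ _) Pb.
by move=> c y ys; apply: H; rewrite inE ys orbT.
Qed.

Lemma foldM_ind (P : B -> Prop) (f : B -> A -> prog B) b s k :
  P b ->
  (forall b x, x \in s -> P b -> P (result (f b x)) /\ steps (f b x) <= k) ->
  P (result (foldM f b s)) /\ steps (foldM f b s) <= size s * k.+1.
Proof.
by move=> Pb H; apply: (foldM_inv (P := fun _ => P) (m := 0)) => // i c x _; apply: H.
Qed.

Lemma steps_mapM (f : A -> prog B) s k :
  {in s, forall x, steps (f x) <= k} -> steps (mapM f s) <= size s * k.+1.
Proof.
elim: s => //= x s IH H; rewrite /steps /= addn0 mulSn !addSn add0n ltnS.
apply: leq_add; first exact: H (mem_head _ _).
by apply: IH => y ys; apply: H; rewrite inE ys orbT.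
Qed.

Lemma steps_filterM (f : A -> prog bool) s k :
  {in s, forall x, steps (f x) <= k} -> steps (filterM f s) <= size s * k.+1.
Proof.
elim: s => //= x s IH H; rewrite /steps /= addn0 mulSn !addSn add0n ltnS.
apply: leq_add; first exact: H (mem_head _ _).
by apply: IH => y ys; apply: H; rewrite inE ys orbT.
Qed.

Lemma steps_findM (f : A -> prog bool) s k :
  {in s, forall x, steps (f x) <= k} -> steps (findM f s) <= size s * k.+1.
Proof.
elim: s => //= x s IH H; rewrite /steps /= mulSn !addSn add0n ltnS.
apply: leq_add; first exact: H (mem_head _ _).
case: (f x).1 => //=.
by apply: IH => y ys; apply: H; rewrite inE ys orbT.
Qed.

End Steps.

Section MoreSteps.
Context {A : eqType} {B : Type}.
Implicit Types (s : seq A).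
Local Open Scope nat_scope.

Lemma steps_allM (f : A -> prog bool) s k :
  {in s, forall x, steps (f x) <= k} -> steps (allM f s) <= size s * k.+1.
Proof.
move=> H; have [|//] := @foldM_ind _ _ (fun _ => True)
  (fun b x => let! c := f x in ret (b && c)) true s k I.
by move=> b x xs _; split=> //; rewrite /steps /= addn0; apply: H.
Qed.

Lemma steps_hasM (f : A -> prog bool) s k :
  {in s, forall x, steps (f x) <= k} -> steps (hasM f s) <= size s * k.+1.
Proof.
move=> H; have [|//] := @foldM_ind _ _ (fun _ => True)
  (fun b x => let! c := f x in ret (b || c)) false s k I.
by move=> b x xs _; split=> //; rewrite /steps /= addn0; apply: H.
Qed.

(** [catM r acc] charges for its first argument only, the fresh block of length at most [l], so the
    growing accumulator is not paid for again; the two extra steps per element come from [catM] and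
    [foldM]. *)
Lemma flatmapM_bounds (f : A -> prog (seq B)) s k l :
  {in s, forall x, steps (f x) <= k /\ size (result (f x)) <= l} ->
  size (result (flatmapM f s)) <= size s * l /\
  steps (flatmapM f s) <= size s * (k + l).+2.
Proof.
move=> H.
have [|] := @foldM_inv _ _ (fun i (acc : seq B) => size acc <= i * l)
  (fun acc x => let! r := f x in catM r acc) [::] s (k + l).+1 0 (leqnn 0).
  move=> i acc x _ xs le; have [stk szl] := H x xs; split.
    by rewrite /result /= size_cat mulSn leq_add.
  by rewrite /steps /= -addnS leq_add // ltnS.
by rewrite add0n.
Qed.

End MoreSteps.

(** * Sets satisfying the precedence constraints *)

Section Dag.
Context {F : realFieldType} (I : ropas F).
Local Notation task := 'I_(ntasks I).
Implicit Types (X Y D : {set task}) (i j x y : task).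
Local Open Scope nat_scope.

Lemma arc_connectN x y : arc x y -> ~~ connect (@arc F I) y x.
Proof.
move=> xy; apply/negP => /connectP[p yp defx].
suff /arc_acyclic : cycle (@arc F I) (y :: p) by [].
by rewrite /= rcons_path yp -defx.
Qed.

(** A rank that drops strictly along arcs, so that choosing a task of extremal height replaces
    induction on the dag. *)
Definition height x := #|[set y | connect (@arc F I) x y]|.

Lemma arc_height x y : arc x y -> height y < height x.
Proof.
move=> xy; apply/proper_card/properP; split.
  apply/subsetP => z; rewrite !inE; apply: connect_trans.
  exact: connect1.
by exists x; rewrite inE ?connect0 // arc_connectN.
Qed.

Lemma closed_setP X :
  reflect (forall i j, j \in X -> arc i j -> i \in X) (closed_set X).
Proof.
apply: (iffP forall_inP) => [H i j jX ij|H j jX].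
  by have /forallP/(_ i)/implyP := H j jX; apply.
by apply/forallP => i; apply/implyP => ij; apply: H ij.
Qed.

Lemma eligibleP X j :
  reflect (j \notin X /\ forall i, arc i j -> i \in X) (j \in eligible X).
Proof.
rewrite inE; apply: (iffP andP) => -[jX H]; split=> //.
  by move=> i ij; have /forallP/(_ i)/implyP := H; apply.
by apply/forallP => i; apply/implyP; apply: H.
Qed.

Lemma closed_set0 : closed_set (set0 : {set task}).
Proof. by apply/closed_setP => i j; rewrite inE. Qed.

Lemma closed_setU X D :
  closed_set X -> D \subset eligible X -> closed_set (X :|: D).
Proof.
move=> /closed_setP clX sDE; apply/closed_setP => i j; rewrite !inE.
case/orP => [jX ij|jD ij]; first by rewrite (clX _ _ jX).
by have /eligibleP[_ /(_ i ij) ->] := subsetP sDE j jD.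
Qed.

Lemma eligible_proper X D :
  D \subset eligible X -> D != set0 -> X \proper X :|: D.
Proof.
move=> sDE /set0Pn[j jD]; apply/properP; split; first exact: subsetUl.
exists j; first by rewrite inE jD orbT.
by have /eligibleP[] := subsetP sDE j jD.
Qed.

(** A missing task of maximal height is eligible, since its parents are higher and so cannot be
    missing. *)
Lemma eligible_neq0 X : X != [set: task] -> eligible X != set0.
Proof.
rewrite -subTset => /subsetPn[x _ xX].
pose y := [arg max_(y > x | y \notin X) height y].
have [yX ymax] : y \notin X /\ forall z, z \notin X -> height z <= height y.
  by rewrite /y; case: arg_maxnP => // z zX H.
apply/set0Pn; exists y; apply/eligibleP; split=> // i iy.
by apply: contraTT (arc_height iy) => /ymax; rewrite -leqNgt.
Qed.

(** A task of least height in [X] has no child in [X] and can be removed. Thus every closed set is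
    reached from the empty one by adding eligible tasks one at a time. *)
Lemma closed_setD1 X : closed_set X -> X != set0 ->
  exists2 j, j \in X & closed_set (X :\ j) && (j \in eligible (X :\ j)).
Proof.
move=> /closed_setP clX /set0Pn[x xX].
pose y := [arg min_(y < x in X) height y].
have [yX ymin] : y \in X /\ forall z, z \in X -> height y <= height z.
  by rewrite /y; case: arg_minnP => // z zX H.
exists y => //; apply/andP; split.
  apply/closed_setP => i j; rewrite !inE => /andP[jy jX] ij.
  rewrite (clX _ _ jX ij) andbT; apply: contraTneq (arc_height ij) => ->.
  by rewrite -leqNgt ymin.
apply/eligibleP; split; first by rewrite !inE eqxx.
move=> i iy; rewrite !inE (clX _ _ yX iy) andbT.
by apply: contraTneq (arc_height iy) => ->; rewrite ltnn.
Qed.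

Lemma closed_set_connect X x y :
  closed_set X -> y \in X -> connect (@arc F I) x y -> x \in X.
Proof.
move=> /closed_setP clX yX /connectP[p].
elim: p x => [|z p IH] x /= => [_ <- //|/andP[xz zp] defy].
exact: clX (IH _ zp defy) xz.
Qed.

(** A missing task of least height has all its children in [X]; closedness would put it in [X] if
    there were any, so it is a missing sink. *)
Lemma completed_closed X : closed_set X -> completed X = (X == [set: task]).
Proof.
move=> clX; apply/idP/eqP => [|->]; last by apply/forallP => j; rewrite inE implybT.
move=> /forallP cX; apply/eqP; rewrite -subTset; apply/negPn/negP => /subsetPn[x _ xX].
pose y := [arg min_(y < x | y \notin X) height y].
have [yX ymin] : y \notin X /\ forall z, z \notin X -> height y <= height z.
  by rewrite /y; case: arg_minnP => // z zX H.
move: (cX y); rewrite (negPf yX) implybF => /negP; apply.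
apply/forallP => z; apply/negP => yz.
have zX : z \in X by apply: contraTT (arc_height yz) => /ymin; rewrite -leqNgt.
by move/negP: yX; apply; apply: (closed_set_connect clX zX); apply: connect1.
Qed.

(** On a path between two eligible tasks, the last arc starts at a parent of the endpoint, which
    lies in [X]; closedness then puts the start of the path in [X]. *)
Lemma antichain_eligible X : closed_set X -> antichain (eligible X).
Proof.
move=> clX; apply/forall_inP => x /eligibleP[xX _].
apply/forall_inP => y /eligibleP[yX pX]; apply/implyP => xy.
apply/negP => /connectP[p xp]; case/lastP: p xp => [_ /= /eqP|p z].
  by rewrite eq_sym (negPf xy).
rewrite rcons_path last_rcons => /andP[xp pz] defz; subst z.
move/negP: xX; apply; apply: (closed_set_connect clX (pX _ pz)).
by apply/connectP; exists p.
Qed.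

Lemma card_antichain X : antichain X -> #|X| <= width I.
Proof. by move=> aX; apply: (leq_bigmax_cond (F := fun X : {set task} => #|X|)). Qed.

Lemma card_eligible X : closed_set X -> #|eligible X| <= width I.
Proof. by move=> /antichain_eligible/card_antichain. Qed.

(** Testing single arcs is enough: a path that ends in a closed set lies entirely in it, so its
    first arc already violates the condition. *)
Definition maximals X := [set x in X | [forall y in X, ~~ arc x y]].

Lemma maximals_above X x : x \in X -> closed_set X ->
  exists2 y, y \in maximals X & connect (@arc F I) x y.
Proof.
move=> xX clX.
pose P y := (y \in X) && connect (@arc F I) x y.
have Px : P x by rewrite /P xX connect0.
pose y := [arg min_(y < x | P y) height y].
have [/andP[yX xy] ymin] : P y /\ forall z, P z -> height y <= height z.
  by rewrite /y; case: arg_minnP => // z zX H.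
exists y => //; rewrite inE yX; apply/forall_inP => z zX; apply/negP => yz.
have /ymin : P z by rewrite /P zX (connect_trans xy) // connect1.
by rewrite leqNgt arc_height.
Qed.

Lemma antichain_maximals X : closed_set X -> antichain (maximals X).
Proof.
move=> clX; apply/forall_inP => x; rewrite inE => /andP[xX /forall_inP xmax].
apply/forall_inP => y; rewrite inE => /andP[yX _]; apply/implyP => xy.
apply/negP => /connectP[[|z p] /=]; first by move=> _ E; rewrite E eqxx in xy.
move=> /andP[xz zp] defy; suff /xmax : z \in X by rewrite xz.
by apply: (closed_set_connect clX yX); apply/connectP; exists p.
Qed.

Lemma maximals_inj : {in [pred X | closed_set X] &, injective maximals}.
Proof.
suff sub X Y : closed_set X -> closed_set Y -> maximals X = maximals Y -> X \subset Y.
  move=> X Y; rewrite !inE => clX clY E.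
  by apply/eqP; rewrite eqEsubset !sub.
move=> clX clY E; apply/subsetP => x xX.
have [y + xy] := maximals_above xX clX.
by rewrite E inE => /andP[yY _]; apply: (closed_set_connect clY yY).
Qed.

(* A closed set is determined by the antichain of its maximal elements. *)
Lemma card_closed_sets :
  #|[set X : {set task} | closed_set X]| <= (ntasks I).+1 ^ width I.
Proof.
set w := width I.
(* An antichain is coded by a [w]-tuple padded with [None], hence the base [(ntasks I).+1]. *)
pose g (f : {ffun 'I_w -> option task}) : {set task} := [set x | Some x \in codom f].
rewrite -(card_in_imset (f := maximals)); last first.
  by move=> X Y; rewrite !inE; apply: maximals_inj.
apply: (@leq_trans #|[set g f | f : {ffun 'I_w -> option task}]|); last first.
  apply: leq_trans (leq_imset_card _ _) _.
  by rewrite card_ffun card_option !card_ord.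
apply/subset_leq_card/subsetP => _ /imsetP[X + ->]; rewrite inE => clX.
have /card_antichain le := antichain_maximals clX.
apply/imsetP; exists [ffun k : 'I_w => nth None (map Some (enum (maximals X))) k] => //.
apply/setP => x; rewrite [RHS]inE -mem_enum.
apply/idP/codomP => [xM|[k]].
  have lt : index x (enum (maximals X)) < w.
    by apply: leq_trans le; rewrite cardE index_mem.
  exists (Ordinal lt); rewrite ffunE /= (nth_map x) ?nth_index //.
  by rewrite index_mem.
rewrite ffunE; case: (ltnP k (size (enum (maximals X)))) => kle.
  by rewrite (nth_map x) // => -[->]; apply: mem_nth.
by rewrite nth_default ?size_map.
Qed.

End Dag.

(** * The admissible evolution and its topological sort *)

Section Evolution.
Context {F : realFieldType} (I : ropas F).
Local Notation task := 'I_(ntasks I).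
Implicit Types (X Y Z D : {set task}) (i j x y : task) (s : seq task).
Local Open Scope nat_scope.

Lemma result_eligibleM X : result (eligibleM X) = enum (eligible X).
Proof.
rewrite /eligibleM result_filterM /= [RHS]/enum_mem -enumT.
apply: eq_filter => j; rewrite /result /= -/(result _) result_allM.
rewrite [RHS]inE; congr (_ && _).
apply/allP/forallP => [H i|H i _]; last exact: H.
by apply: H; rewrite mem_enum.
Qed.

Lemma size_subsetsM s : size (result (subsetsM s)) = 2 ^ size s.
Proof.
elim: s => //= j s IH; rewrite /result /= size_cat -/(result _) result_mapM.
by rewrite size_map IH expnS mul2n addnn.
Qed.

Lemma mem_subsetsM s D : (D \in result (subsetsM s)) = (D \subset [set j in s]).
Proof.
elim: s D => [|j s IH] D /=; rewrite /result /=.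
  by rewrite inE; apply/eqP/idP => [->|]; rewrite ?sub0set // set_nil subset0 => /eqP.
rewrite -/(result (mapM _ _)) result_mapM mem_cat -/(result (subsetsM s)) IH.
apply/orP/idP => [[/mapP[D' + ->]|]|].
- rewrite IH /result /= subUset sub1set !inE eqxx /= => /subset_trans; apply.
  by apply/subsetP => x; rewrite !inE => ->; rewrite orbT.
- move/subset_trans; apply.
  by apply/subsetP => x; rewrite !inE => ->; rewrite orbT.
move=> sD; have [jD|jD] := boolP (j \in D).
  left; apply/mapP; exists (D :\ j); last by rewrite /result /= setD1K.
  rewrite IH; apply/subsetP => x; rewrite !inE => /andP[xj /(subsetP sD)].
  by rewrite !inE (negPf xj).
right; apply/subsetP => x xD; have := subsetP sD x xD.
by rewrite !inE => /orP[/eqP xj|//]; rewrite -xj xD in jD.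
Qed.

Lemma uniq_subsetsM s : uniq s -> uniq (result (subsetsM s)).
Proof.
elim: s => //= j s IH /andP[js us]; rewrite /result /=.
rewrite -/(result (mapM _ _)) result_mapM cat_uniq -/(result (subsetsM s)) IH // andbT.
have notin D : D \in result (subsetsM s) -> j \notin D.
  by rewrite mem_subsetsM => /subsetP H; apply: contra js => /H; rewrite inE.
apply/andP; split.
  rewrite map_inj_in_uniq ?IH // => D D' /notin jD /notin jD' /= E.
  rewrite /result /= in E.
  by rewrite -(setU1K jD) E setU1K.
apply/hasPn => D /notin jD; apply: contra jD => /mapP[D' _ ->].
by rewrite /result /= !inE eqxx.
Qed.

Lemma result_nonempty_subsetsM s :
  result (nonempty_subsetsM s) = [seq D <- result (subsetsM s) | D != set0].
Proof. exact: result_filterM. Qed.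

Lemma mem_nonempty_subsetsM s D :
  (D \in result (nonempty_subsetsM s)) = (D != set0) && (D \subset [set j in s]).
Proof. by rewrite result_nonempty_subsetsM mem_filter mem_subsetsM. Qed.

Lemma uniq_nonempty_subsetsM s : uniq s -> uniq (result (nonempty_subsetsM s)).
Proof.
by move=> us; rewrite result_nonempty_subsetsM filter_uniq // uniq_subsetsM.
Qed.

Lemma size_nonempty_subsetsM s : size (result (nonempty_subsetsM s)) <= 2 ^ size s.
Proof.
rewrite result_nonempty_subsetsM size_filter.
by apply: leq_trans (count_size _ _) _; rewrite size_subsetsM.
Qed.

Lemma result_successorsM X : result (successorsM X)
  = [seq X :|: D | D <- result (nonempty_subsetsM (enum (eligible X)))].
Proof.
by rewrite -result_eligibleM; apply: (result_mapM (unionM X)).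
Qed.

Lemma successorsP X Z :
  reflect (exists D, [/\ D \subset eligible X, D != set0 & Z = X :|: D])
    (Z \in result (successorsM X)).
Proof.
rewrite result_successorsM.
have E : [set j in enum (eligible X)] = eligible X.
  by apply/setP => j; rewrite inE mem_enum.
apply: (iffP mapP) => -[D]; rewrite ?mem_nonempty_subsetsM ?E.
  by case/andP => D0 sD ->; exists D.
by case=> sD D0 ->; exists D; rewrite // mem_nonempty_subsetsM E D0.
Qed.

Lemma size_successorsM X : closed_set X -> size (result (successorsM X)) <= 2 ^ width I.
Proof.
move=> clX; rewrite result_successorsM size_map.
apply: leq_trans (size_nonempty_subsetsM _) _.
by rewrite -cardE leq_pexp2l // card_eligible.
Qed.

Lemma closed_successor X Z :
  closed_set X -> Z \in result (successorsM X) -> closed_set Z.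
Proof. by move=> clX /successorsP[D [sD _ ->]]; apply: closed_setU. Qed.

Lemma proper_successor X Z : Z \in result (successorsM X) -> X \proper Z.
Proof. by move=> /successorsP[D [sD D0 ->]]; apply: eligible_proper. Qed.

Lemma result_memM X (ns : seq {set task}) : result (memM X ns) = (X \in ns).
Proof.
by rewrite /memM result_hasM -has_pred1; apply: eq_has => Y; rewrite /= eq_sym.
Qed.

Lemma result_insertM (ns : seq {set task}) X :
  result (insertM ns X) = if X \in ns then ns else X :: ns.
Proof. by rewrite -result_memM. Qed.

Definition nodes_inv (ns : seq {set task}) := uniq ns /\ {in ns, forall X, closed_set X}.

Lemma nodes_inv_size ns : nodes_inv ns -> size ns <= (ntasks I).+1 ^ width I.
Proof.
case=> uns cns; apply: leq_trans (card_closed_sets I); rewrite -(card_uniqP uns).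
by apply/subset_leq_card/subsetP => X /cns; rewrite inE.
Qed.

Lemma insertM_inv ns X : nodes_inv ns -> closed_set X -> nodes_inv (result (insertM ns X)).
Proof.
move=> [uns cns] clX; rewrite result_insertM; case: ifPn => // nX.
split=> /=; first by rewrite nX.
by move=> Y; rewrite inE => /orP[/eqP->|/cns].
Qed.

Lemma mem_insert_all ns new Z :
  (Z \in result (foldM (@insertM F I) ns new)) = (Z \in ns) || (Z \in new).
Proof.
elim: new ns => [|X new IH] ns; first by rewrite orbF.
rewrite -[result _]/(result (foldM (@insertM F I) (result (insertM ns X)) new)).
rewrite IH result_insertM !inE; case: ifPn => [nX|nX]; last by rewrite inE orbCA orbA.
by case: eqP => [->|]; rewrite ?nX.
Qed.

Definition passM (ns : seq {set task}) : prog (seq {set task}) :=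
  let! new := flatmapM (@successorsM F I) ns in foldM (@insertM F I) ns new.

Lemma mem_passM ns Z : (Z \in result (passM ns))
  = (Z \in ns) || has (fun X => Z \in result (successorsM X)) ns.
Proof. by rewrite [LHS]mem_insert_all result_flatmapM. Qed.

Lemma passM_inv ns : nodes_inv ns -> nodes_inv (result (passM ns)).
Proof.
move=> nsI; apply: (foldM_result_ind (P := nodes_inv)) => // ns' Z.
rewrite result_flatmapM => /hasP[X Xns ZX] ns'I; apply: insertM_inv => //.
by apply: closed_successor ZX; apply: nsI.2.
Qed.

Lemma nodes_inv0 : nodes_inv [:: set0 : {set task}].
Proof. by split=> // X; rewrite inE => /eqP->; apply: closed_set0. Qed.

Lemma evolution_nodesM_inv : nodes_inv (result (evolution_nodesM I)).
Proof.
apply: (foldM_result_ind (P := nodes_inv)); first exact: nodes_inv0.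
by move=> ns j _; apply: passM_inv.
Qed.

Lemma mem_evolution_nodesM X : (X \in result (evolution_nodesM I)) = closed_set X.
Proof.
apply/idP/idP; first exact: evolution_nodesM_inv.2.
have -> : result (evolution_nodesM I) =
    foldl (fun ns _ => result (passM ns)) [:: set0] (enum task) by apply: result_foldM.
(* The induction is on the number of passes: after [k] of them all closed sets with at most [k]
   tasks are listed. *)
have : #|X| <= size (enum task) by rewrite -cardE max_card.
elim/last_ind: (enum task) X => [|s j IH] X.
  by rewrite leqn0 cards_eq0 => /eqP->; rewrite inE.
rewrite size_rcons foldl_rcons mem_passM => leX clX.
have [->|X0] := eqVneq X set0.
  by rewrite IH ?cards0 // closed_set0.
have [x xX /andP[clXx xE]] := closed_setD1 clX X0.
apply/orP; right; apply/hasP; exists (X :\ x).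
  by apply: IH => //; rewrite (cardsD1 x X) xX in leX.
apply/successorsP; exists [set x]; split; first by rewrite sub1set.
  by apply/set0Pn; exists x; rewrite inE.
by rewrite setUC setD1K.
Qed.

Lemma mem_evolution_arcsM ns X Z :
  ((X, Z) \in result (evolution_arcsM ns)) = (X \in ns) && (Z \in result (successorsM X)).
Proof.
rewrite result_flatmapM; apply/hasP/andP => [[X' X'ns]|[Xns ZX]].
  rewrite -[result _]/(result (mapM _ _)) result_mapM => /mapP[Z' Z'X' [-> ->]].
  by rewrite X'ns.
exists X => //; rewrite -[result _]/(result (mapM _ _)) result_mapM.
by apply/mapP; exists Z.
Qed.

(** * Topological sorting of the evolution *)

Definition remaining_sourceM (arcs : seq ({set task} * {set task})) ns X :=
  let! b := hasM (fun a : {set task} * {set task} =>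
    let! hd := eq_setM a.2 X in
    let! tl := memM a.1 ns in
    ret (hd && tl)) arcs in
  ret (~~ b).

Lemma result_remaining_sourceM arcs ns X :
  result (remaining_sourceM arcs ns X) = ~~ has (fun a => (a.2 == X) && (a.1 \in ns)) arcs.
Proof.
rewrite [LHS]/(~~ result (hasM _ _)) result_hasM; congr (~~ _); apply: eq_has => a.
by rewrite -(result_memM a.1).
Qed.

Definition removeM X (ns : seq {set task}) :=
  filterM (fun Z => let! b := eq_setM Z X in ret (~~ b)) ns.

Lemma result_removeM X ns : result (removeM X ns) = [seq Z <- ns | Z != X].
Proof. exact: result_filterM. Qed.

Lemma toposortMS fuel arcs ns : toposortM fuel.+1 arcs ns =
  let! src := findM (remaining_sourceM arcs ns) ns in
  if src is Some X then
    let! ns' := removeM X ns in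
    let! r := toposortM fuel arcs ns' in
    charge 1 (X :: r)
  else ret [::].
Proof. by []. Qed.

(** Arcs increase strictly for inclusion, so a remaining node of least cardinality has no incoming
    arc; the search for a source therefore never fails, and the fuel [size ns] is exactly what is
    needed. *)
Lemma toposortM_correct (arcs : seq ({set task} * {set task})) ns :
  {in arcs, forall a : {set task} * {set task}, a.1 \proper a.2} -> uniq ns ->
  let order := result (toposortM (size ns) arcs ns) in
  perm_eq order ns /\ pairwise (fun X Z => (Z, X) \notin arcs) order.
Proof.
move=> arcsP; move: {-2}(size ns) (erefl (size ns)) => fuel.
elim: fuel ns => [|fuel IH] ns; first by case: ns.
move=> szns uns; rewrite toposortMS.
have [X Xns Xmin] : exists2 X, X \in ns & {in ns, forall Z, ~~ (Z \proper X)}.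
  case: ns szns {uns} => // X0 ns _.
  have X0in : X0 \in X0 :: ns by rewrite mem_head.
  exists [arg min_(X < X0 in X0 :: ns) #|X|]; case: arg_minnP => // X Xin Xmin.
  by move=> Z /Xmin; rewrite leqNgt; apply: contra => /proper_card.
have srcX : result (remaining_sourceM arcs ns X).
  rewrite result_remaining_sourceM; apply/hasPn => a /arcsP a12.
  by apply/negP => /andP[/eqP a2 /Xmin]; rewrite -a2 a12.
have [Y [E Yns srcY]] : exists Y, [/\ result (findM (remaining_sourceM arcs ns) ns) = Some Y,
    Y \in ns & result (remaining_sourceM arcs ns Y)].
  rewrite result_findM; case E: [seq _ <- _ | _] => [|Y r].
    by have := mem_filter (fun X => result (remaining_sourceM arcs ns X)) X ns;
      rewrite E Xns srcX.
  have : Y \in [seq X <- ns | result (remaining_sourceM arcs ns X)] by rewrite E mem_head.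
  by rewrite mem_filter => /andP[srcY Yns]; exists Y.
have Erem : [seq Z <- ns | Z != Y] = rem Y ns by rewrite rem_filter.
have szr : fuel = size [seq Z <- ns | Z != Y] by rewrite Erem size_rem // -szns.
have [permr pwr] := IH _ szr (filter_uniq _ uns).
rewrite /= /result /= -/(result (findM (remaining_sourceM arcs ns) ns)) E /=.
rewrite -/(result (removeM Y ns)) result_removeM; set r := result _ in permr pwr *.
split.
  rewrite (perm_trans _ (_ : perm_eq (Y :: [seq Z <- ns | Z != Y]) _)) ?perm_cons //.
  by rewrite Erem perm_sym perm_to_rem.
rewrite /= pwr andbT; apply/allP => Z; rewrite (perm_mem permr) mem_filter => /andP[_ Zns].
apply/negP => ZY; rewrite result_remaining_sourceM in srcY.
by move/hasPn/(_ _ ZY): srcY; rewrite /= eqxx Zns.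
Qed.

Definition opt_order :=
  let ns := result (evolution_nodesM I) in
  result (toposortM (size ns) (result (evolution_arcsM ns)) ns).

Lemma evolution_arcs_proper ns :
  {in result (@evolution_arcsM F I ns), forall a : {set task} * {set task}, a.1 \proper a.2}.
Proof. by move=> [X Z]; rewrite mem_evolution_arcsM => /andP[_ /proper_successor]. Qed.

Lemma perm_opt_order : perm_eq opt_order (result (evolution_nodesM I)).
Proof.
by case: (toposortM_correct (@evolution_arcs_proper (result (evolution_nodesM I)))
  evolution_nodesM_inv.1).
Qed.

Lemma pairwise_opt_order :
  pairwise (fun X Z => (Z, X) \notin result (evolution_arcsM (result (evolution_nodesM I))))
    opt_order.
Proof.
by case: (toposortM_correct (@evolution_arcs_proper (result (evolution_nodesM I)))
  evolution_nodesM_inv.1).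
Qed.

Lemma uniq_opt_order : uniq opt_order.
Proof. by rewrite (perm_uniq perm_opt_order) evolution_nodesM_inv.1. Qed.

Lemma mem_opt_order X : (X \in opt_order) = closed_set X.
Proof. by rewrite (perm_mem perm_opt_order) mem_evolution_nodesM. Qed.

(** Stated for suffixes because the table is built from the end of the list: when [Y] is processed,
    all its successors already have entries. *)
Definition topological (s : seq {set task}) := forall pre Y post, s = pre ++ Y :: post ->
  {subset result (successorsM Y) <= post}.

Lemma opt_order_topological : topological opt_order.
Proof.
move=> pre Y post E Z ZY.
have clY : closed_set Y by rewrite -mem_opt_order E mem_cat mem_head orbT.
have : Z \in opt_order by rewrite mem_opt_order (closed_successor clY).
rewrite E mem_cat inE => /orP[Zpre|/orP[/eqP ZeqY|//]]; last first.
  by have := proper_successor ZY; rewrite ZeqY properxx.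
have := pairwise_opt_order.
rewrite E pairwise_cat => /andP[/allrelP/(_ Z Y Zpre (mem_head _ _)) + _].
by rewrite mem_evolution_arcsM mem_evolution_nodesM clY ZY.
Qed.

End Evolution.

(** * One round *)

Section Round.
Context {F : realFieldType} (I : ropas F).
Local Notation task := 'I_(ntasks I).
Local Notation worker := 'I_(nworkers I).
Local Notation outcome := {ffun worker -> bool}.
Implicit Types (A : assignment I) (w : outcome) (D : {set task}) (G : {set task} -> F).

Definition expect A G : F := \sum_w outcome_prob A w * G (executed A w).

Definition exact_prob A D : F := \sum_(w | executed A w == D) outcome_prob A w.

Definition fail_prob A (j : task) : F := \prod_(i | A i == Some j) (1 - prob i j).

Lemma success_prob_bounds A i : 0 <= success_prob A i <= 1.
Proof.
by rewrite /success_prob; case: (A i) => [j|]; rewrite ?prob_bounds // lexx ler01.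
Qed.

Lemma outcome_prob_ge0 A w : 0 <= outcome_prob A w.
Proof.
apply: prodr_ge0 => i _; have /andP[p0 p1] := success_prob_bounds A i.
by case: (w i) => //; rewrite subr_ge0.
Qed.

Lemma sum_outcome_prob_family A (Q : worker -> pred bool) :
  \sum_(w in family Q) outcome_prob A w
  = \prod_i \sum_(b | Q i b) (if b then success_prob A i else 1 - success_prob A i).
Proof. by rewrite bigA_distr_big_dep. Qed.

Lemma sum_outcome_prob A : \sum_w outcome_prob A w = 1.
Proof.
rewrite /outcome_prob -(bigA_distr_bigA (fun i b =>
  if b then success_prob A i else 1 - success_prob A i)).
by apply: big1 => i _; rewrite big_bool /= addrC subrK.
Qed.

Lemma prod_fail_prob A (P : pred task) :
  \prod_(j | P j) fail_prob A j
  = \prod_i (if A i is Some j then (if P j then 1 - prob i j else 1) else 1).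
Proof.
rewrite /fail_prob (exchange_big_dep xpredT) //=; apply: eq_bigr => i _.
case E: (A i) => [j|]; last by rewrite big_pred0 // => j; rewrite andbF.
case: ifPn => Pj.
  rewrite (big_pred1 j) // => k; rewrite (inj_eq Some_inj) [in RHS]/= [in RHS]eq_sym.
  by case: eqP => [<-|]; rewrite ?Pj ?andbF.
rewrite big_pred0 // => k; rewrite (inj_eq Some_inj).
by apply/negP => /andP[Pk /eqP jk]; rewrite jk Pk in Pj.
Qed.

(** The event that nothing outside [D] is executed constrains each worker separately, so its
    probability is a product over workers, which [prod_fail_prob] regroups by tasks. *)
Lemma sum_exact_prob_subset A D :
  \sum_(D' : {set task} | D' \subset D) exact_prob A D' = \prod_(j | j \notin D) fail_prob A j.
Proof.
rewrite prod_fail_prob /exact_prob.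
transitivity (\sum_(w | executed A w \subset D) outcome_prob A w).
  rewrite [RHS](partition_big (executed A) (fun D' : {set task} => D' \subset D)) //=.
  apply: eq_bigr => D' sD; apply: eq_bigl => w.
  by case: eqP => [->|]; rewrite ?sD ?andbF.
pose Q i : pred bool := fun b => b ==> (if A i is Some j then j \in D else true).
rewrite (eq_bigl (fun w => w \in family Q)) => [|w]; last first.
  apply/subsetP/familyP => [H i|H j].
    rewrite unfold_in /Q; apply/implyP => wi; case E: (A i) => [j|//].
    by apply: H; rewrite inE; apply/existsP; exists i; rewrite wi E eqxx.
  rewrite inE => /existsP[i /andP[wi /eqP Ai]].
  by have := H i; rewrite unfold_in /Q wi Ai.
rewrite sum_outcome_prob_family; apply: eq_bigr => i _.
rewrite (big_mkcond (Q i)) /= big_bool /= /Q /= /success_prob.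
case: (A i) => [j|] /=; last by rewrite subr0 add0r.
by case: (j \in D); rewrite /= ?add0r // addrC subrK.
Qed.

(** Summing over [D'] expands a product of sums: a task of [D] contributes [(1 - f j) + f j], which
    is 1, and any other task only [f j]. *)
Lemma sum_product_subset (f : task -> F) D :
  \sum_(D' : {set task} | D' \subset D) \prod_j (if j \in D' then 1 - f j else f j)
  = \prod_(j | j \notin D) f j.
Proof.
rewrite [RHS]big_mkcond /=.
transitivity (\prod_j ((if j \in D then 1 - f j else 0) + f j)); last first.
  by apply: eq_bigr => j _; case: (j \in D); rewrite /= ?add0r // subrK.
rewrite bigA_distr [LHS]big_mkcond /=; apply: eq_bigr => D' _.
case: ifPn => [sD|/subsetPn[j jD' jD]]; last first.
  by apply/esym/eqP/prodf_eq0; exists j; rewrite // jD' (negPf jD).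
by apply: eq_bigr => j _; case: ifP => // /(subsetP sD) ->.
Qed.

(** Uniqueness in Moebius inversion on the subset lattice: by induction on the cardinality, the
    terms of proper subsets cancel. *)
Lemma eq_subset_sums (f g : {set task} -> F) :
  (forall D, \sum_(D' : {set task} | D' \subset D) f D'
    = \sum_(D' : {set task} | D' \subset D) g D') -> f =1 g.
Proof.
move=> H D; have [n] := ubnP #|D|; elim: n D => // n IH D leD.
have := H D; rewrite (bigD1 D) //= [RHS](bigD1 D) //= => E.
apply: (@addIr _ (\sum_(i : {set task} | (i \subset D) && (i != D)) g i)).
rewrite -E; congr (_ + _).
apply: eq_bigr => D' /andP[sD neD]; apply/esym/IH.
rewrite ltnS in leD; apply: leq_trans leD.
by rewrite proper_card // properEneq neD.
Qed.

(* Both sides have the same sums over the subsets of any set: the probability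
   that no task outside of it is executed. *)
Lemma exact_probE A D :
  exact_prob A D = \prod_j (if j \in D then 1 - fail_prob A j else fail_prob A j).
Proof.
apply: (eq_subset_sums (f := exact_prob A) (g := fun D =>
  \prod_j (if j \in D then 1 - fail_prob A j else fail_prob A j))) => {}D.
by rewrite sum_exact_prob_subset sum_product_subset.
Qed.

Lemma exact_prob0 A :
  exact_prob A set0 = \prod_i (if A i is Some j then 1 - prob i j else 1).
Proof.
have := sum_exact_prob_subset A set0; rewrite prod_fail_prob (big_pred1 set0) => [->|D].
  by apply: eq_bigr => i _; case: (A i) => // j; rewrite inE.
by rewrite subset0.
Qed.

Lemma exact_prob_ge0 A D : 0 <= exact_prob A D.
Proof. by apply: sumr_ge0 => w _; apply: outcome_prob_ge0. Qed.

Lemma sum_exact_prob A : \sum_D exact_prob A D = 1.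
Proof.
rewrite -(sum_outcome_prob A) [RHS](partition_big (executed A) xpredT) //.
Qed.

Lemma expectE A G : expect A G = \sum_D exact_prob A D * G D.
Proof.
rewrite /expect (partition_big (executed A) xpredT) //=; apply: eq_bigr => D _.
by rewrite /exact_prob mulr_suml; apply: eq_bigr => w /eqP->.
Qed.

Lemma expect_cst A c : expect A (fun=> c) = c.
Proof. by rewrite /expect -mulr_suml sum_outcome_prob mul1r. Qed.

Lemma expectB A G G' : expect A (fun D => G D - G' D) = expect A G - expect A G'.
Proof.
by rewrite /expect -sumrB; apply: eq_bigr => w _; rewrite mulrBr.
Qed.

(* Couples all assignments: every worker tosses a coin for every task. *)
Definition world := {ffun worker -> {ffun task -> bool}}.

Definition world_prob (u : world) : F :=
  \prod_i \prod_j (if u i j then prob i j else 1 - prob i j).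

Definition world_outcome A (u : world) : outcome :=
  [ffun i => if A i is Some j then u i j else false].

Definition world_executed A u := executed A (world_outcome A u).

Lemma world_prob_ge0 u : 0 <= world_prob u.
Proof.
apply: prodr_ge0 => i _; apply: prodr_ge0 => j _; have /andP[p0 p1] := prob_bounds i j.
by case: (u i j) => //; rewrite subr_ge0.
Qed.

Lemma sum_coins i (P : {ffun task -> bool} -> bool) (j : task) (b : bool) :
  P =1 (fun v => v j == b) ->
  \sum_(v : {ffun task -> bool} | P v) \prod_k (if v k then prob i k else 1 - prob i k)
  = if b then prob i j else 1 - prob i j.
Proof.
move=> PE; pose Q k : pred bool := fun c => (k == j) ==> (c == b).
rewrite (eq_bigl (fun v => v \in family Q)) => [|v]; last first.
  rewrite PE; apply/idP/familyP => [H k|/(_ j)]; last by rewrite unfold_in /Q eqxx.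
  by rewrite unfold_in /Q; apply/implyP => /eqP->.
rewrite -(bigA_distr_big_dep _ (fun k c => if c then prob i k else 1 - prob i k)).
rewrite (bigD1 j) //= [X in _ * X]big1 ?mulr1 => [|k kj]; last first.
  by rewrite big_mkcond big_bool /= /Q (negPf kj) /= addrC subrK.
by rewrite (big_pred1 b) // => c; rewrite /= /Q eqxx.
Qed.

Lemma sum_all_coins i :
  \sum_(v : {ffun task -> bool}) \prod_k (if v k then prob i k else 1 - prob i k) = 1 :> F.
Proof.
rewrite -(bigA_distr_bigA (fun k c => if c then prob i k else 1 - prob i k)).
by apply: big1 => k _; rewrite big_bool /= addrC subrK.
Qed.

(** Each worker reads only the coin of its own task, and its other coins sum out to 1; an idle
    worker reads none, its success being impossible. *)
Lemma outcome_prob_world A w :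
  outcome_prob A w = \sum_(u | world_outcome A u == w) world_prob u.
Proof.
pose Q i : pred {ffun task -> bool} :=
  fun v => (if A i is Some j then v j else false) == w i.
rewrite (eq_bigl (fun u : world => u \in family Q)) => [|u]; last first.
  apply/eqP/familyP => [E i|H]; first by rewrite unfold_in /Q -E ffunE.
  by apply/ffunP => i; rewrite ffunE; apply/eqP; have := H i; rewrite unfold_in.
rewrite -(bigA_distr_big_dep _ (fun i (v : {ffun task -> bool}) =>
  \prod_j (if v j then prob i j else 1 - prob i j))).
apply: eq_bigr => i _; rewrite /success_prob /Q; case E: (A i) => [j|].
  by rewrite (@sum_coins i _ j (w i)).
case: (w i) => /=; first by rewrite big_pred0.
by rewrite subr0 sum_all_coins.
Qed.

Lemma expect_world A G : expect A G = \sum_u world_prob u * G (world_executed A u).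
Proof.
rewrite /expect [RHS](partition_big (world_outcome A) xpredT) //=; apply: eq_bigr => w _.
rewrite outcome_prob_world mulr_suml; apply: eq_bigr => u /eqP <-.
by [].
Qed.

End Round.

(** * The table computed by OPT satisfies the Bellman equations *)

Section Evaluate.
Context {F : realFieldType} (cost : F -> F -> nat) (I : ropas F).
Local Notation task := 'I_(ntasks I).
Local Notation worker := 'I_(nworkers I).
Implicit Types (X Y Z D U : {set task}) (A : seq (worker * task)) (B : assignment I).

Definition nonidling Y B := forall i, exists2 j, B i = Some j & j \in eligible Y.

Lemma executed_eligible Y B w :
  (forall i j, B i = Some j -> j \in eligible Y) -> executed B w \subset eligible Y.
Proof.
by move=> BE; apply/subsetP => j; rewrite inE => /existsP[i /andP[_ /eqP /BE]].
Qed.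

Lemma nonidling_eligible Y B : nonidling Y B ->
  forall i j, B i = Some j -> j \in eligible Y.
Proof. by move=> BE i j; have [k -> kE [<-]] := BE i. Qed.

Lemma mem_assignmentsM (ws : seq worker) (E : seq task) A :
  (A \in result (assignmentsM ws E)) = (unzip1 A == ws) && all [in E] (unzip2 A).
Proof.
elim: ws A => [|i ws IH] A.
  by rewrite /= inE; case: A.
rewrite -[result _]/(result (flatmapM _ _)) result_flatmapM.
apply/hasP/andP => [[A' + ]|].
  rewrite IH => /andP[/eqP ws' allE]; rewrite result_mapM => /mapP[j jE ->] /=.
  by rewrite ws' eqxx jE.
case: A => [[]//|[i' j] A] /= [/eqP[-> wsE] /andP[jE allE]].
exists A; first by rewrite IH wsE eqxx.
by rewrite result_mapM; apply/mapP; exists j.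
Qed.

Lemma assignment_of_mem A i j :
  uniq (unzip1 A) -> (i, j) \in A -> assignment_of A i = Some j.
Proof.
rewrite ffunE; elim: A => //= -[i' j'] A IH /= /andP[i'A uA].
rewrite inE xpair_eqE => /orP[/andP[/eqP-> /eqP->]|ijA]; first by rewrite eqxx.
case: eqP => [E|_]; last exact: IH.
by move: i'A; rewrite E; case/negP; apply/mapP; exists (i, j).
Qed.

Definition valid_assignment Y A :=
  unzip1 A = enum worker /\ {subset unzip2 A <= eligible Y}.

Lemma valid_assignmentP Y A :
  reflect (valid_assignment Y A)
    (A \in result (assignmentsM (enum worker) (enum (eligible Y)))).
Proof.
rewrite mem_assignmentsM; apply: (iffP andP) => -[].
  by move=> /eqP A1 /allP A2; split=> // j /A2; rewrite /= mem_enum.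
by move=> -> A2; split=> //; apply/allP => j /A2; rewrite /= mem_enum.
Qed.

Lemma valid_assignment_nonidling Y A : valid_assignment Y A -> nonidling Y (assignment_of A).
Proof.
move=> [A1 A2] i.
have /mapP[[i' j] ijA /= ii'] : i \in unzip1 A by rewrite A1 mem_enum.
exists j; first by apply: assignment_of_mem; rewrite ?A1 ?enum_uniq // ii'.
by apply: A2; apply/mapP; exists (i', j).
Qed.

Lemma nonidling_valid_assignment Y B : nonidling Y B ->
  exists2 A, valid_assignment Y A & assignment_of A = B.
Proof.
move=> BE; pose A := pmap (fun i => omap (pair i) (B i)) (enum worker).
have memA i j : ((i, j) \in A) = (B i == Some j).
  rewrite mem_pmap; apply/mapP/eqP => [[i' _]|Bi].
    by have [j' Bi' _] := BE i'; rewrite Bi' => -[-> ->].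
  by exists i; rewrite ?mem_enum ?Bi.
have A1 : unzip1 A = enum worker.
  rewrite /A; elim: (enum worker) => //= i s IH.
  by have [j -> _ /=] := BE i; rewrite [X in _ :: X]IH.
exists A; last first.
  apply/ffunP => i; have [j Bi _] := BE i; rewrite Bi.
  by apply: assignment_of_mem; rewrite ?A1 ?enum_uniq // memA Bi.
split=> // j /mapP[[i j'] /=]; rewrite memA => /eqP Bi ->.
exact: nonidling_eligible BE _ _ Bi.
Qed.

Lemma prod_valid_assignment Y A (phi : worker -> task -> F) : valid_assignment Y A ->
  \prod_(ij <- A) phi ij.1 ij.2
  = \prod_i (if assignment_of A i is Some j then phi i j else 1).
Proof.
move=> [A1 _]; rewrite -[RHS]big_enum /= -A1 big_map; apply: eq_big_seq => -[i j] ijA /=.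
by rewrite (assignment_of_mem _ ijA) // A1 enum_uniq.
Qed.

Lemma result_all_failM A : result (all_failM cost A) = \prod_(ij <- A) (1 - prob ij.1 ij.2).
Proof.
rewrite [LHS]result_foldM; elim/last_ind: A => [|A ij IH]; first by rewrite big_nil.
by rewrite foldl_rcons IH -cats1 big_cat big_seq1.
Qed.

Lemma all_failM_exact Y A : valid_assignment Y A ->
  result (all_failM cost A) = exact_prob (assignment_of A) set0.
Proof.
by move=> vA; rewrite result_all_failM exact_prob0
  (prod_valid_assignment (fun i j => 1 - prob i j) vA).
Qed.

Lemma result_task_failM Y A j : valid_assignment Y A ->
  result (task_failM cost A j) = fail_prob (assignment_of A) j.
Proof.
move=> vA; transitivity (\prod_(ij <- A) (if ij.2 == j then 1 - prob ij.1 ij.2 else 1)).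
  rewrite [LHS]result_foldM; elim/last_ind: {vA}A => [|A ij IH]; first by rewrite big_nil.
  rewrite foldl_rcons IH -cats1 big_cat big_seq1 /=.
  by rewrite /bind /charge /result /=; case: ifP => _ //=; rewrite mulr1.
rewrite (prod_valid_assignment (fun i k => if k == j then 1 - prob i k else 1) vA).
rewrite /fail_prob [RHS]big_mkcond; apply: eq_bigr => i _.
case: (assignment_of A i) => //= k; rewrite (inj_eq Some_inj).
by case: eqP => // ->.
Qed.

Lemma result_assigned_tasksM (E : seq task) A :
  result (assigned_tasksM E A) = [seq j <- E | j \in unzip2 A].
Proof.
rewrite [LHS]result_filterM; apply: eq_filter => j.
rewrite result_hasM; apply/hasP/mapP => [[ij ijA /eqP E1]|[ij ijA ->]]; exists ij => //.
exact/eqP.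
Qed.

Lemma result_exactlyM Y A (U : seq task) D : valid_assignment Y A ->
  result (exactlyM cost A U D) = \prod_(j <- U)
    (if j \in D then 1 - fail_prob (assignment_of A) j else fail_prob (assignment_of A) j).
Proof.
move=> vA; rewrite [LHS]result_foldM.
elim/last_ind: U => [|U j IH]; first by rewrite big_nil.
rewrite foldl_rcons IH -cats1 big_cat big_seq1 /= -(result_task_failM j vA).
by rewrite /bind /charge /result /=; case: ifP.
Qed.

Lemma fail_prob_unassigned B j : (forall i, B i != Some j) -> fail_prob B j = 1.
Proof. by move=> H; rewrite /fail_prob big_pred0 // => i; apply/negbTE. Qed.

Lemma exact_prob_unassigned B D j :
  (forall i, B i != Some j) -> j \in D -> exact_prob B D = 0.
Proof.
move=> H jD; rewrite exact_probE (bigD1 j) //= jD fail_prob_unassigned //.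
by rewrite subrr mul0r.
Qed.

Definition table_value (table : seq (entry I)) X : F := result (lookupM table X).

Definition round_value B (G : {set task} -> F) : F :=
  \sum_(D : {set task} | D != set0) exact_prob B D * G D.

Lemma expect_round_value B G : expect B G = exact_prob B set0 * G set0 + round_value B G.
Proof. by rewrite expectE (bigD1 set0). Qed.

(** OPT multiplies and sums over the assigned tasks [U] only. This agrees with the sum over all task
    sets: an unassigned task fails with probability 1, so it contributes a factor 1 outside [D] and
    makes the probability vanish inside [D]. *)
Lemma result_evaluateM table Y A : valid_assignment Y A ->
  let B := assignment_of A in
  result (evaluateM cost table Y (enum (eligible Y)) A)
  = if exact_prob B set0 == 1 then None else
    Some ((1 + round_value B (fun D => table_value table (Y :|: D))) / (1 - exact_prob B set0)).
Proof.
move=> vA B; rewrite /B -(all_failM_exact vA).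
set U := result (assigned_tasksM (enum (eligible Y)) A).
have -> : result (evaluateM cost table Y (enum (eligible Y)) A) =
    if 1 - result (all_failM cost A) == 0 then None else
    Some (result (foldM (fun acc D =>
      let! aD := exactlyM cost A U D in
      let! Z := unionM Y D in
      let! SZ := lookupM table Z in
      let! x := mulM cost aD SZ in
      addM cost acc x) 1 (result (nonempty_subsetsM U))) / (1 - result (all_failM cost A))).
  by rewrite /U /evaluateM /bind /result /=; case: ifP.
rewrite subr_eq0 eq_sym; case: ifP => //= _; congr (Some (_ / _)).
have UE : U = [seq j <- enum (eligible Y) | j \in unzip2 A] by apply: result_assigned_tasksM.
have uU : uniq U by rewrite UE filter_uniq ?enum_uniq.
have U1 j : j \notin U -> forall i, assignment_of A i != Some j.
  move=> jU i; apply/eqP => Bi; case/negP: jU; rewrite UE mem_filter mem_enum.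
  have [A1 A2] := vA.
  have /mapP[[i' j'] ijA /= ii'] : i \in unzip1 A by rewrite A1 mem_enum.
  have := assignment_of_mem _ ijA; rewrite A1 enum_uniq -ii' Bi => /(_ isT)[jj'].
  have jA : j \in unzip2 A by apply/mapP; exists (i', j'); rewrite /= ?jj'.
  by rewrite jA A2.
rewrite result_foldM.
have -> (s : seq {set task}) : foldl (fun b x => result
   (let! aD := exactlyM cost A U x in let! Z := unionM Y x in
    let! SZ := lookupM table Z in let! x0 := mulM cost aD SZ in addM cost b x0)) 1 s
   = 1 + \sum_(D <- s) result (exactlyM cost A U D) * table_value table (Y :|: D).
  elim/last_ind: s => [|s D IH]; first by rewrite big_nil addr0.
  by rewrite foldl_rcons IH -cats1 big_cat big_seq1 addrA.
congr (1 + _); rewrite big_uniq ?uniq_nonempty_subsetsM //=.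
rewrite /round_value [LHS]big_mkcond [RHS]big_mkcond; apply: eq_bigr => D _ /=.
rewrite mem_nonempty_subsetsM; case: (D =P set0) => //= _.
case: ifPn => [sDU|/subsetPn[j jD]].
  rewrite (result_exactlyM _ _ vA) exact_probE; congr (_ * _).
  rewrite big_uniq //= [LHS]big_mkcond; apply: eq_bigr => j _.
  case: ifPn => // jU; rewrite fail_prob_unassigned; last exact: U1.
  by case: ifPn => // /(subsetP sDU); rewrite inE (negPf jU).
by rewrite inE => /U1/exact_prob_unassigned->; rewrite ?mul0r.
Qed.

End Evaluate.

(** * Minimization over assignments and backward construction of the table *)

Section Table.
Context {F : realFieldType} (cost : F -> F -> nat) (I : ropas F).
Local Notation task := 'I_(ntasks I).
Local Notation worker := 'I_(nworkers I).
Implicit Types (X Y Z D : {set task}) (A : seq (worker * task)) (B : assignment I).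
Implicit Types (table : seq (entry I)).

Definition keep_best (v : option F) (best : option (F * seq (worker * task))) A :=
  match v, best with
  | None, _ => best
  | Some x, None => Some (x, A)
  | Some x, Some (y, B) => if x < y then Some (x, A) else Some (y, B)
  end.

Lemma minimizeM_rcons table Y E As A :
  result (minimizeM cost table Y E (rcons As A))
  = keep_best (result (evaluateM cost table Y E A)) (result (minimizeM cost table Y E As)) A.
Proof.
rewrite /minimizeM !result_foldM foldl_rcons.
move: (foldl _ _ As) (evaluateM _ _ _ _ _) => best [v k].
by case: v best => [x|] [[y B]|].
Qed.

Lemma result_minimizeM table Y E As :
  match result (minimizeM cost table Y E As) with
  | None => {in As, forall A, result (evaluateM cost table Y E A) = None}
  | Some (v, A) =>
      [/\ A \in As, result (evaluateM cost table Y E A) = Some v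
        & {in As, forall A' x, result (evaluateM cost table Y E A') = Some x -> v <= x}]
  end.
Proof.
elim/last_ind: As => [|As A IH] //.
rewrite minimizeM_rcons; move: (result (minimizeM _ _ _ _ _)) IH => best IH.
have inA' A' : (A' \in rcons As A) = (A' == A) || (A' \in As) by rewrite mem_rcons inE.
case Ev: (result (evaluateM cost table Y E A)) => [x|]; rewrite /keep_best; last first.
  case: best IH => [[v B] [BAs Bv Bmin]|none]; last first.
    by move=> A'; rewrite inA' => /orP[/eqP->|/none].
  split=> //; first by rewrite inA' BAs orbT.
  by move=> A'; rewrite inA' => /orP[/eqP->|/Bmin//] x; rewrite Ev.
case: best IH => [[v B] [BAs Bv Bmin]|none]; last first.
  split=> //; first by rewrite inA' eqxx.
  move=> A'; rewrite inA' => /orP[/eqP->|/none E1] y; last by rewrite E1.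
  by rewrite Ev => -[->].
case: ltP => xv; split=> //; rewrite ?inA' ?eqxx ?BAs ?orbT //.
  move=> A'; rewrite inA' => /orP[/eqP->|A'As] y; first by rewrite Ev => -[->].
  by move/(Bmin _ A'As); apply: le_trans (ltW xv).
move=> A'; rewrite inA' => /orP[/eqP->|A'As] y; last exact: Bmin.
by rewrite Ev => -[<-].
Qed.

(** [opt_regimen] with the table as a parameter, so that partially built tables can be treated by
    induction. *)
Definition table_regimen table : regimen I := fun Y =>
  if [seq e <- table | e.1 == Y] is e :: _ then assignment_of e.2.2 else [ffun=> None].

Lemma table_value_cons table (e : entry I) X :
  table_value (e :: table) X = if e.1 == X then e.2.1 else table_value table X.
Proof.
by rewrite /table_value /lookupM {1}/bind /result /= /bind /=; case: ifP.
Qed.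

Lemma table_regimen_cons table (e : entry I) X :
  table_regimen (e :: table) X = if e.1 == X then assignment_of e.2.2 else table_regimen table X.
Proof. by rewrite /table_regimen /=; case: ifP. Qed.

(** The expectation includes the empty set of executed tasks, so the equation is free of division
    and also covers assignments that fail with certainty. The bound on [exact_prob] is what later
    makes the self-loop a contraction. *)
Definition bellman_at (V : {set task} -> F) (S : regimen I) Y :=
  [/\ forall B, nonidling Y B -> V Y <= 1 + expect B (fun D => V (Y :|: D)),
      nonidling Y (S Y), exact_prob (S Y) set0 < 1
    & V Y = 1 + expect (S Y) (fun D => V (Y :|: D))].

Definition bellman (V : {set task} -> F) (S : regimen I) :=
  [/\ V [set: task] = 0, forall Y, closed_set Y -> 0 <= V Y,
      forall i, S [set: task] i = None
    & forall Y, closed_set Y -> Y != [set: task] -> bellman_at V S Y].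

Lemma eq_expect B (G G' : {set task} -> F) :
  (forall w, G (executed B w) = G' (executed B w)) -> expect B G = expect B G'.
Proof. by move=> E; apply: eq_bigr => w _; rewrite E. Qed.

(** The conditions at [Y] involve only values at [Y] and its successors, so they survive when the
    table is extended to nodes earlier in the order. *)
Lemma eq_bellman_at V S V' S' Y : S Y = S' Y ->
  (forall D, D \subset eligible Y -> V (Y :|: D) = V' (Y :|: D)) ->
  bellman_at V S Y -> bellman_at V' S' Y.
Proof.
move=> SE VE [H1 H2 H3 H4].
have VY : V Y = V' Y by rewrite -[Y]setU0 VE ?sub0set.
have expE B : nonidling Y B ->
    expect B (fun D => V (Y :|: D)) = expect B (fun D => V' (Y :|: D)).
  move=> BE; apply: eq_expect => w; apply: VE; apply: executed_eligible.
  exact: nonidling_eligible BE.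
split; rewrite -?SE -?VY //; last by rewrite -expE.
by move=> B BE; rewrite -expE //; apply: H1.
Qed.

Lemma exact_prob0_le1 B : exact_prob B set0 <= 1.
Proof.
rewrite -(sum_exact_prob B) (bigD1 set0) //= lerDl.
by apply: sumr_ge0 => D _; apply: exact_prob_ge0.
Qed.

(** All workers are put on one eligible task; [prob_cover] provides one who may succeed. Hence the
    minimization in OPT always finds a finite value. *)
Lemma exact_prob0_lt1 Y : Y != [set: task] ->
  exists2 B, nonidling Y B & exact_prob B set0 < 1.
Proof.
move=> /eligible_neq0/set0Pn[j jE]; exists [ffun=> Some j].
  by move=> i; exists j; rewrite ?ffunE.
have [i pi] := prob_cover j; rewrite exact_prob0 (bigD1 i) //= ffunE.
apply: le_lt_trans (_ : 1 - prob i j < 1); last by rewrite ltrBlDr ltrDl.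
rewrite -[X in _ <= X]mulr1; apply: ler_wpM2l.
  by rewrite subr_ge0; have /andP[] := prob_bounds i j.
apply: prodr_ile1 => k _; rewrite ffunE; have /andP[p0 p1] := prob_bounds k j.
by rewrite subr_ge0 p1 lerBlDr lerDl.
Qed.

Lemma round_value_ge0 B (G : {set task} -> F) :
  (forall D, exact_prob B D != 0 -> D != set0 -> 0 <= G D) -> 0 <= round_value B G.
Proof.
move=> G0; apply: sumr_ge0 => D Dn0; have [->|e0] := eqVneq (exact_prob B D) 0.
  by rewrite mul0r.
by rewrite mulr_ge0 ?exact_prob_ge0 ?G0.
Qed.

Lemma exact_prob_nonidling Y B D : nonidling Y B -> exact_prob B D != 0 -> D \subset eligible Y.
Proof.
move=> BE; apply: contraNT => /subsetPn[j jD jE]; rewrite (exact_prob_unassigned (j := j)) //.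
by move=> i; apply: contra jE => /eqP; apply: nonidling_eligible.
Qed.

(** With [a] the probability that nothing is executed and [r] the contribution of the nonempty [D],
    the quotient [(1 + r) / (1 - a)] solves [v = 1 + a * v + r]; its minimality, multiplied by
    [1 - a], is the Bellman inequality. *)
Lemma entryM_bellman table Y : closed_set Y -> Y != [set: task] ->
  (forall D, D \subset eligible Y -> D != set0 -> 0 <= table_value table (Y :|: D)) ->
  let e := result (entryM cost table Y) in
  [/\ e.1 = Y, 0 <= e.2.1
    & bellman_at (table_value (e :: table)) (table_regimen (e :: table)) Y].
Proof.
move=> clY YT V0 e.
have -> : e = (Y, if result (minimizeM cost table Y (enum (eligible Y))
    (result (assignmentsM (enum worker) (enum (eligible Y))))) is Some vA
    then vA else (0, [::])) by rewrite -result_eligibleM.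
have := result_minimizeM table Y (enum (eligible Y))
  (result (assignmentsM (enum worker) (enum (eligible Y)))).
case: (result (minimizeM _ _ _ _ _)) => [[v A]|none]; last first.
  have [B /nonidling_valid_assignment[A vA AB] lt1] := exact_prob0_lt1 YT.
  have := none A; move/(_ (introT (valid_assignmentP _ _) vA)).
  by rewrite result_evaluateM // AB; case: ifP => // /eqP E; rewrite E ltxx in lt1.
case=> /valid_assignmentP vA.
rewrite result_evaluateM //; set B := assignment_of A.
case: ifPn => // e1 [vE] vmin.
have BE : nonidling Y B by apply: valid_assignment_nonidling.
have lt1 : exact_prob B set0 < 1 by rewrite lt_neqAle e1 exact_prob0_le1.
pose V := table_value ((Y, (v, A)) :: table).
have VY : V Y = v by rewrite /V table_value_cons eqxx.
have rvE B' : nonidling Y B' -> round_value B' (fun D => V (Y :|: D))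
    = round_value B' (fun D => table_value table (Y :|: D)).
  move=> B'E; apply: eq_bigr => D D0; have [->|eD] := eqVneq (exact_prob B' D) 0.
    by rewrite !mul0r.
  (* The new entry is not consulted: a nonempty set of eligible tasks leads strictly above [Y]. *)
  rewrite /V table_value_cons /= ifF //; apply/negP => /eqP YE.
  by have := eligible_proper (exact_prob_nonidling B'E eD) D0; rewrite -YE properxx.
have rv0 B' : nonidling Y B' -> 0 <= round_value B' (fun D => table_value table (Y :|: D)).
  move=> B'E; apply: round_value_ge0 => D eD D0; apply: V0 => //.
  exact: exact_prob_nonidling eD.
have v0 : 0 <= v by rewrite -vE divr_ge0 ?subr_ge0 ?addr_ge0 ?rv0 ?ler01 ?ltW.
have SY : table_regimen ((Y, (v, A)) :: table) Y = B by rewrite table_regimen_cons eqxx.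
split=> //; split; rewrite ?SY // -/V VY.
  move=> B' B'E; rewrite expect_round_value setU0 VY rvE //.
  (* A certain failure is not among the minimized values, but then the self-loop alone already
     contributes [v]. *)
  have [E|ne1] := eqVneq (exact_prob B' set0) 1.
    by rewrite E mul1r addrCA lerDl addr_ge0 ?ler01 ?rv0.
  have lt1' : 0 < 1 - exact_prob B' set0.
    by rewrite subr_gt0 lt_neqAle ne1 exact_prob0_le1.
  have [A' vA' A'B'] := nonidling_valid_assignment B'E.
  have := vmin A' (introT (valid_assignmentP _ _) vA').
  rewrite result_evaluateM // A'B' (negPf ne1) => /(_ _ erefl).
  by rewrite ler_pdivlMr // mulrBr mulr1 lerBlDr addrCA mulrC addrC.
rewrite expect_round_value setU0 VY rvE //.
have d0 : 1 - exact_prob B set0 != 0 by rewrite subr_eq0 eq_sym.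
move: vE => /(congr1 (fun x => x * (1 - exact_prob B set0))); rewrite divfK // => vE.
by rewrite addrCA vE mulrBr mulr1 mulrC addrC subrK.
Qed.

Definition bellman_on (s : seq {set task}) V (S : regimen I) :=
  [/\ V [set: task] = 0, {in s, forall Y, 0 <= V Y},
      forall i, S [set: task] i = None
    & {in s, forall Y, Y != [set: task] -> bellman_at V S Y}].

Lemma topological_cons Y (s : seq {set task}) : topological (Y :: s) -> topological s.
Proof. by move=> H pre Z post E; apply: (H (Y :: pre)); rewrite E. Qed.

Lemma successor_in Y D (s : seq {set task}) :
  topological (Y :: s) -> D \subset eligible Y -> D != set0 -> Y :|: D \in s.
Proof. by move=> /(_ [::] Y s erefl) H sD D0; apply/H/successorsP; exists D. Qed.

Lemma tableM_bellman (s : seq {set task}) : s != [::] -> uniq s ->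
  {in s, forall Y, closed_set Y} -> topological s ->
  let table := result (tableM cost s) in
  [set: task] \in s /\ bellman_on s (table_value table) (table_regimen table).
Proof.
elim: s => // Y [|Z s] IH _.
  (* The last node is the whole task set, as any other would have a successor after it. *)
  move=> _ _ top /=; have -> : Y = [set: task].
    apply/eqP; apply: contraT => /eligible_neq0 E0.
    by have := successor_in top (subxx _) E0.
  split; first by rewrite mem_head.
  split=> [|X|i|X]; rewrite ?inE ?table_value_cons ?eqxx //.
  - by move=> /eqP->; rewrite ?table_value_cons ?eqxx.
  - by rewrite table_regimen_cons eqxx ffunE.
  - by move=> /eqP->; rewrite eqxx.
move=> /andP[Ys us] cls top.
have [] := IH isT us _ (topological_cons top) => [X Xs|].
  by apply: cls; rewrite inE Xs orbT.
set s' := Z :: s in us Ys cls top *; set table := result _ => Ts [VT V0 ST bel].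
have -> : result (tableM cost (Y :: s')) = result (entryM cost table Y) :: table by [].
have YT : Y != [set: task] by apply: contraNneq Ys => ->.
have clY : closed_set Y by apply: cls; rewrite mem_head.
have [] := @entryM_bellman table Y clY YT.
  by move=> D sD D0; apply: V0; apply: successor_in.
set e := result _ => eY e0 belY.
split; first by rewrite inE Ts orbT.
have VX X : X \in s' -> table_value (e :: table) X = table_value table X.
  move=> Xs; rewrite table_value_cons eY ifF //.
  by apply/negP => /eqP E; rewrite E Xs in Ys.
split; first by rewrite VX.
  move=> X; rewrite inE => /orP[/eqP->|Xs]; first by rewrite table_value_cons eY eqxx.
  by rewrite VX ?V0.
  by move=> i; rewrite table_regimen_cons eY (negPf YT) ST.
move=> X; rewrite inE => /orP[/eqP->//|Xs] XT.
apply: eq_bellman_at (bel X Xs XT).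
  rewrite table_regimen_cons eY ifF //.
  by apply/negP => /eqP E; rewrite E Xs in Ys.
move=> D sD; rewrite VX //; have [->|D0] := eqVneq D set0; first by rewrite setU0.
have [pre [post E]] : exists pre, exists post, s' = pre ++ X :: post.
  by case/splitPr: Xs => p1 p2; exists p1, p2.
have := topological_cons top E (_ : X :|: D \in result (successorsM X)).
by move=> H; rewrite E mem_cat inE H ?orbT //; apply/successorsP; exists D.
Qed.

Definition opt_value Y : F := table_value (result (tableM cost (opt_order I))) Y.

Lemma opt_bellman : bellman opt_value (opt_regimen cost I).
Proof.
have cl Y : Y \in opt_order I -> closed_set Y by rewrite mem_opt_order.
have [|_ [VT V0 ST bel]] := tableM_bellman _ (uniq_opt_order I) cl (@opt_order_topological _ I).
  by have := closed_set0 I; rewrite -mem_opt_order; case: (opt_order I).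
split=> // [Y clY|Y clY YT]; first by apply: V0; rewrite mem_opt_order.
by apply: bel YT; rewrite mem_opt_order.
Qed.

End Table.

(** * Monotonicity of the value function *)

Section Monotone.
Context {F : realFieldType} (I : ropas F).
Local Notation task := 'I_(ntasks I).
Local Notation worker := 'I_(nworkers I).
Implicit Types (X Y Z D : {set task}) (B : assignment I).
Context (V : {set task} -> F) (S : regimen I) (belV : bellman V S).

(** [B] imitated in a state [Y] where more has been done: workers that would idle or repeat a task
    of [Y] help with [j], all others keep their task and hence their coin. *)
Definition redirect Y (j : task) B : assignment I :=
  [ffun i => if B i is Some k then (if k \in Y then Some j else Some k) else Some j].

Lemma world_executed_redirect Y Y' j B u : Y \subset Y' ->
  Y :|: world_executed B u \subset Y' :|: world_executed (redirect Y' j B) u.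
Proof.
move=> sYY'; apply/subsetP => k; rewrite inE => /orP[/(subsetP sYY')|]; rewrite in_setU.
  by move=> ->.
rewrite inE => /existsP[i /andP[+ /eqP Bi]]; rewrite ffunE Bi => uik.
case: (boolP (k \in Y')) => //= kY'; rewrite inE; apply/existsP; exists i.
by rewrite !ffunE Bi (negPf kY') uik eqxx.
Qed.

Lemma redirect_nonidling Y Y' j B : j \in eligible Y' -> Y \subset Y' ->
  (forall i k, B i = Some k -> k \in eligible Y) -> nonidling Y' (redirect Y' j B).
Proof.
move=> jE sYY' BE i; rewrite ffunE; case Bi: (B i) => [k|]; last by exists j.
case: ifPn => kY'; first by exists j.
exists k => //; apply/eligibleP; split=> // l lk.
by have /eligibleP[_ /(_ l lk)] := BE _ _ Bi; apply: (subsetP sYY').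
Qed.

Lemma expect_empty B : expect B (fun D => (D == set0)%:R) = exact_prob B set0.
Proof.
rewrite expectE (bigD1 set0) //= eqxx mulr1 big1 ?addr0 // => D /negPf->.
by rewrite mulr0.
Qed.

(** The assignment of [S] at [Y] is redirected at [Y'] and the two games are compared coin by coin.
    Unless both stand still, induction applies; the measure counts the tasks missing from either set
    because one game may advance alone. *)
Lemma bellman_mono Y Y' :
  closed_set Y -> closed_set Y' -> Y \subset Y' -> V Y' <= V Y.
Proof.
have [VT V0 _ bel] := belV.
have [n] := ubnP (#|~: Y| + #|~: Y'|)%N; elim: n Y Y' => // n IH Y Y' leY clY clY' sYY'.
have [->|Y'T] := eqVneq Y' [set: task]; first by rewrite VT V0.
have YT : Y != [set: task].
  by apply: contraNneq Y'T => YT; rewrite YT subTset in sYY'.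
have [_ BE lt1 VY] := bel Y clY YT; set B := S Y in BE lt1 VY.
have /set0Pn[j jE] := eligible_neq0 Y'T.
have B'E := redirect_nonidling jE sYY' (nonidling_eligible BE).
set B' := redirect Y' j B in B'E.
have [/(_ _ B'E) VY' _ _ _] := bel Y' clY' Y'T.
(* [b] marks the worlds where neither game moves, for which only the difference to be bounded is
   available. *)
pose b u := (world_executed B u == set0) && (world_executed B' u == set0).
have pointwise u : V (Y' :|: world_executed B' u) - V (Y :|: world_executed B u)
    <= (b u)%:R * (V Y' - V Y).
  rewrite /b; case: eqP => [->|/eqP e0] /=; rewrite ?setU0; last first.
    rewrite mul0r subr_le0; apply: IH; rewrite ?closed_setU ?world_executed_redirect //.
    - rewrite ltnS in leY; apply: leq_trans leY.
      rewrite -addSn leq_add // ?subset_leq_card ?setCS ?subsetUl //.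
      rewrite proper_card // properC ?setCK.
      by apply: eligible_proper e0; apply: executed_eligible; apply: nonidling_eligible.
    - by apply: executed_eligible; apply: nonidling_eligible.
    - by apply: executed_eligible; apply: nonidling_eligible.
  case: eqP => [->|/eqP e0] /=; rewrite ?setU0 ?mul1r //.
  rewrite mul0r subr_le0; apply: IH; rewrite ?closed_setU //.
  - rewrite ltnS in leY; apply: leq_trans leY.
    rewrite -addnS leq_add2l proper_card // properC ?setCK.
    by apply: eligible_proper e0; apply: executed_eligible; apply: nonidling_eligible.
  - by apply: executed_eligible; apply: nonidling_eligible.
  - exact: subset_trans sYY' (subsetUl _ _).
pose beta := \sum_u world_prob u * (b u)%:R.
(* Standing still in both games is at most as likely as [S Y] executing nothing. Then
   [V Y' - V Y <= beta * (V Y' - V Y)] forces the difference to be nonpositive. *)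
have beta1 : beta < 1.
  apply: le_lt_trans lt1; rewrite -expect_empty expect_world; apply: ler_sum => u _.
  by rewrite ler_wpM2l ?world_prob_ge0 // ler_nat /b; case: eqP => // _; case: eqP.
have : V Y' - V Y <= beta * (V Y' - V Y).
  apply: le_trans (_ : expect B' (fun D => V (Y' :|: D)) - expect B (fun D => V (Y :|: D)) <= _).
    by rewrite [X in _ - X <= _]VY opprD addrA lerD2r lerBlDr addrC.
  rewrite !expect_world -sumrB mulr_suml; apply: ler_sum => u _.
  by rewrite -mulrBr -mulrA ler_wpM2l ?world_prob_ge0.
rewrite -subr_ge0 -[X in _ - X]mul1r -mulrBl nmulr_rge0 ?subr_lt0 //.
by rewrite subr_le0.
Qed.

(** Assigned tasks are eligible, hence outside [Y], so [redirect] only moves the idle workers. With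
    the same coins they can only enlarge the executed set, and [bellman_mono] compares the
    values. *)
Lemma bellman_idling Y B : closed_set Y -> Y != [set: task] ->
  (forall i j, B i = Some j -> j \in eligible Y) ->
  V Y <= 1 + expect B (fun D => V (Y :|: D)).
Proof.
move=> clY YT BE; have [_ _ _ /(_ Y clY YT)[opt _ _ _]] := belV.
have /set0Pn[j jE] := eligible_neq0 YT.
have B'E := redirect_nonidling jE (subxx _) BE.
apply: le_trans (opt _ B'E) _; rewrite lerD2l !expect_world; apply: ler_sum => u _.
rewrite ler_wpM2l ?world_prob_ge0 //; apply: bellman_mono.
- by apply: closed_setU clY (executed_eligible _ BE).
- by apply: closed_setU clY (executed_eligible _ (nonidling_eligible B'E)).
- exact: world_executed_redirect.
Qed.

End Monotone.

(** * The law of the executed set *)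

Section Law.
Context {F : realFieldType} (I : ropas F).
Local Notation task := 'I_(ntasks I).
Implicit Types (X Y Z D : {set task}) (B : assignment I) (G : {set task} -> F).
Context (S : regimen I) (regS : is_regimen S).

Definition mean k G : F := \sum_Y law S k Y * G Y.

Lemma sum_round_prob Y G :
  \sum_Z round_prob S Y Z * G Z = expect (S Y) (fun D => G (Y :|: D)).
Proof.
rewrite /expect (partition_big (fun w => Y :|: executed (S Y) w) xpredT) //=.
by apply: eq_bigr => Z _; rewrite /round_prob mulr_suml; apply: eq_bigr => w /eqP->.
Qed.

Lemma law_ge0 k Y : 0 <= law S k Y.
Proof.
elim: k Y => [|k IH] Y /=; first exact: ler0n.
apply: sumr_ge0 => X _; rewrite mulr_ge0 //; apply: sumr_ge0 => w _.
exact: outcome_prob_ge0.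
Qed.

Lemma mean0 G : mean 0 G = G set0.
Proof.
rewrite /mean (bigD1 set0) //= eqxx mul1r big1 ?addr0 // => Y Y0.
by rewrite /= (negPf Y0) mul0r.
Qed.

Lemma meanS k G :
  mean k.+1 G = mean k (fun Y => expect (S Y) (fun D => G (Y :|: D))).
Proof.
rewrite /mean /=; under eq_bigr do rewrite mulr_suml.
rewrite exchange_big /=; apply: eq_bigr => Y _; rewrite -sum_round_prob mulr_sumr.
by apply: eq_bigr => Z _; rewrite mulrA.
Qed.

(** This is why the comparison lemmas for [mean] ask for nothing at the other sets, where regimens
    take junk values. *)
Lemma law_closed k Y : law S k Y != 0 -> closed_set Y.
Proof.
elim: k Y => [|k IH] Y /=.
  by case: (Y =P set0) => [->|_]; rewrite ?eqxx ?closed_set0.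
apply: contraNT => nclY; apply/eqP/big1 => X _.
have [->|/IH clX] := eqVneq (law S k X) 0; first by rewrite mul0r.
rewrite /round_prob big_pred0 ?mulr0 // => w; apply: contraNF nclY => /eqP<-.
by apply: closed_setU clX (executed_eligible _ (regS clX)).
Qed.

Lemma le_mean k G G' : (forall Y, closed_set Y -> G Y <= G' Y) -> mean k G <= mean k G'.
Proof.
move=> le; apply: ler_sum => Y _.
have [->|/law_closed clY] := eqVneq (law S k Y) 0; first by rewrite !mul0r.
by rewrite ler_wpM2l ?law_ge0 ?le.
Qed.

Lemma eq_mean k G G' : (forall Y, closed_set Y -> G Y = G' Y) -> mean k G = mean k G'.
Proof.
move=> E; apply: eq_bigr => Y _.
have [->|/law_closed clY] := eqVneq (law S k Y) 0; first by rewrite !mul0r.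
by rewrite E.
Qed.

Lemma meanD k G G' : mean k (fun Y => G Y + G' Y) = mean k G + mean k G'.
Proof. by rewrite -big_split; apply: eq_bigr => Y _; rewrite mulrDr. Qed.

Lemma meanB k G G' : mean k (fun Y => G Y - G' Y) = mean k G - mean k G'.
Proof. by rewrite -sumrB; apply: eq_bigr => Y _; rewrite mulrBr. Qed.

Lemma meanZ k G c : mean k (fun Y => G Y * c) = mean k G * c.
Proof. by rewrite mulr_suml; apply: eq_bigr => Y _; rewrite mulrA. Qed.

(** This is [P(T > k)] for the completion time [T]: an executed set is closed, and by
    [completed_closed] it is incomplete exactly when some task is missing. *)
Definition survival k : F := mean k (fun Y => (Y != [set: task])%:R).

Lemma survival_ge0 k : 0 <= survival k.
Proof. by apply: sumr_ge0 => Y _; rewrite mulr_ge0 ?law_ge0 ?ler0n. Qed.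

Lemma completion_prob_ge0 k : 0 <= completion_prob S k.
Proof.
case: k => [|k] /=; first exact: ler0n.
apply: sumr_ge0 => Y _; apply: sumr_ge0 => Z _; rewrite mulr_ge0 ?law_ge0 //.
by apply: sumr_ge0 => w _; apply: outcome_prob_ge0.
Qed.

Lemma completion_prob0 : completion_prob S 0 = 1 - survival 0.
Proof.
rewrite /survival mean0 /= completed_closed ?closed_set0 //.
by case: eqP; rewrite ?subr0 ?subrr.
Qed.

Lemma completion_probS k : completion_prob S k.+1 = survival k - survival k.+1.
Proof.
rewrite /survival meanS -meanB.
transitivity (mean k (fun Y => (~~ completed Y)%:R *
    expect (S Y) (fun D => (completed (Y :|: D))%:R))).
  rewrite /mean /= big_mkcond; apply: eq_bigr => Y _; case: ifP => _; last first.
    by rewrite mul0r mulr0.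
  rewrite mul1r -(sum_round_prob Y (fun Z => (completed Z)%:R)) mulr_sumr big_mkcond.
  apply: eq_bigr => Z _; case: ifP => _; by rewrite ?mulr1 ?mulr0.
apply: eq_mean => Y clY; rewrite completed_closed //.
have [->|YT] := eqVneq Y [set: task]; rewrite /= ?mul0r ?mul1r.
  rewrite sub0r; apply/esym/eqP; rewrite oppr_eq0; apply/eqP.
  by apply: big1 => w _; rewrite setTU eqxx mulr0.
rewrite -[X in X - _](expect_cst (S Y)) -expectB; apply: eq_expect => w.
rewrite completed_closed; last exact: closed_setU clY (executed_eligible _ (regS clY)).
by case: eqP; rewrite ?subr0 ?subrr.
Qed.

Section Value.
Context (V : {set task} -> F).

(** A sum in place of a maximum: only its finiteness matters, as it multiplies survival
    probabilities that go to 0 in the relevant case. *)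
Definition value_bound : F := \sum_Y `|V Y|.

Lemma value_bound_ge0 : 0 <= value_bound.
Proof. by apply: sumr_ge0 => Y _; apply: normr_ge0. Qed.

Lemma mean_value_le k : V [set: task] = 0 -> mean k V <= survival k * value_bound.
Proof.
move=> VT; rewrite -meanZ; apply: le_mean => Y _.
have [->|YT] := eqVneq Y [set: task]; first by rewrite VT mul0r.
rewrite mul1r (le_trans (ler_norm _)) // /value_bound (bigD1 Y) //= lerDl.
by apply: sumr_ge0 => Z _; apply: normr_ge0.
Qed.

Lemma expect_setT B : V [set: task] = 0 -> expect B (fun D => V ([set: task] :|: D)) = 0.
Proof. by move=> VT; apply: big1 => w _; rewrite setTU VT mulr0. Qed.

(** The remainder after [n] rounds is the mean of [V], which vanishes at the whole set. It is kept
    in the bound because an arbitrary regimen [S] need not make it small. *)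
Lemma bellman_lower S0 n : bellman V S0 ->
  V set0 <= \sum_(k < n) survival k + survival n * value_bound.
Proof.
move=> bel; have [VT _ _ _] := bel.
apply: le_trans (_ : \sum_(k < n) survival k + mean n V <= _); last first.
  by rewrite lerD2l mean_value_le.
elim: n => [|n IH]; first by rewrite big_ord0 add0r mean0.
apply: le_trans IH _; rewrite big_ord_recr /= -addrA lerD2l meanS -meanD.
apply: le_mean => Y clY; have [->|YT] := eqVneq Y [set: task].
  by rewrite VT expect_setT // addr0.
exact: (bellman_idling bel clY YT (regS clY)).
Qed.

(** Here the iteration is an exact identity, and its remainder [mean n V] is nonnegative. *)
Lemma bellman_upper n : bellman V S -> \sum_(k < n) survival k <= V set0.
Proof.
move=> [VT V0 _ bel].
have -> : V set0 = \sum_(k < n) survival k + mean n V.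
  elim: n => [|n ->]; first by rewrite big_ord0 add0r mean0.
  rewrite big_ord_recr /= -addrA meanS -meanD; congr (_ + _); apply: eq_mean => Y clY.
  have [->|YT] := eqVneq Y [set: task]; first by rewrite VT expect_setT // addr0.
  by have [_ _ _ ->] := bel Y clY YT.
rewrite lerDl; apply: le_trans (_ : mean n (fun=> 0) <= _); last exact: le_mean.
by rewrite /mean big1 // => Y _; rewrite mulr0.
Qed.

End Value.
End Law.

Lemma bellman_is_regimen (F : realFieldType) (I : ropas F)
    (V : {set 'I_(ntasks I)} -> F) (S : regimen I) :
  bellman V S -> is_regimen S.
Proof.
move=> [_ _ ST bel] Y clY i j SYi; have [YT|YT] := eqVneq Y [set: 'I_(ntasks I)].
  by move: SYi; rewrite YT ST.
by have [_ /nonidling_eligible SE _ _] := bel Y clY YT; apply: SE SYi.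
Qed.

(** * Running time of the construction of the admissible evolution *)

Section Bind.
Context {A B : Type}.

Lemma steps_bind (m : prog A) (f : A -> prog B) :
  steps (bind m f) = (steps m + steps (f (result m)))%N.
Proof. by []. Qed.

Lemma result_bind (m : prog A) (f : A -> prog B) : result (bind m f) = result (f (result m)).
Proof. by []. Qed.

Lemma steps_charge k (a : A) : steps (charge k a) = k.
Proof. by []. Qed.

Lemma steps_ret (a : A) : steps (ret a) = 0%N.
Proof. by []. Qed.

End Bind.

Definition stepsE := (@steps_bind, @steps_charge, @steps_ret).

Section EvolutionTime.
Local Open Scope nat_scope.

(** The step bounds are functions of the number [t] of tasks, the width bound [w] and a bound [N] on
    the number of nodes. They use only sums, products and constants such as [2 ^ w], so that
    polynomial growth can be read off their shape. *)
Definition eligible_time t := t * (1 + t * 3).+1.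
Definition subsets_time t k := 2 ^ k * (t + 3) + 2 ^ k * t.+1.
Definition successors_time t w := eligible_time t + subsets_time t w + 2 ^ w * t.+1.
Definition pass_time t w N :=
  N * (successors_time t w + 2 ^ w).+2 + N * 2 ^ w * (N * t.+1).+1.
Definition nodes_time t w N := t + t * (pass_time t w N).+1.
Definition arcs_time t w N := N * (successors_time t w + 2 ^ w + 2 ^ w).+2.
Definition source_time t w N := N * 2 ^ w * (t + N * t.+1).+1.
Definition toposort_time t w N := N * (N * (source_time t w N).+1 + N * t.+1 + 1).

Context {F : realFieldType} (I : ropas F) (w : nat) (width_le : width I <= w).
Local Notation task := 'I_(ntasks I).
Local Notation t := (ntasks I).
Local Notation N := (t.+1 ^ w).
Implicit Types (X Y Z D : {set task}) (s : seq task) (ns : seq {set task}).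

Lemma steps_eligibleM X : steps (eligibleM X) <= eligible_time t.
Proof.
apply: leq_trans (steps_filterM (k := 1 + t * 3) _) _; last by rewrite size_enum_ord.
move=> j _; rewrite !stepsE addn0 leq_add2l.
apply: leq_trans (steps_allM (k := 2) _) _; last by rewrite size_enum_ord.
by move=> i _; rewrite !stepsE.
Qed.

Lemma steps_subsetsM s : steps (subsetsM s) <= 2 ^ size s * (t + 3).
Proof.
elim: s => [|j s IH]; first by rewrite mul1n leq_addr.
rewrite -[subsetsM _]/(let! r := subsetsM s in let! r' := mapM (add_taskM j) r in catM r' r).
rewrite !stepsE result_mapM size_map size_subsetsM expnS mul2n -addnn mulnDl leq_add //.
have st : steps (mapM (add_taskM j) (result (subsetsM s))) <= 2 ^ size s * t.+1.
  by rewrite -size_subsetsM; apply: steps_mapM => D _; rewrite stepsE.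
have : 0 < 2 ^ size s by rewrite expn_gt0.
by move: st; set p := 2 ^ _; nia.
Qed.

Lemma steps_nonempty_subsetsM s k : size s <= k ->
  steps (nonempty_subsetsM s) <= subsets_time t k.
Proof.
move=> sk; have le : 2 ^ size s <= 2 ^ k by rewrite leq_pexp2l.
rewrite stepsE; apply: leq_add.
  by apply: leq_trans (steps_subsetsM s) _; rewrite leq_mul2r le orbT.
apply: leq_trans (steps_filterM (k := t) _) _; first by move=> D _; rewrite stepsE.
by rewrite size_subsetsM leq_mul2r le orbT.
Qed.

Lemma card_eligible_le X : closed_set X -> #|eligible X| <= w.
Proof. by move=> clX; apply: leq_trans (card_eligible clX) width_le. Qed.

Lemma size_successorsM_le X : closed_set X -> size (result (successorsM X)) <= 2 ^ w.
Proof. by move=> clX; apply: leq_trans (size_successorsM clX) _; rewrite leq_pexp2l. Qed.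

Lemma steps_successorsM X : closed_set X -> steps (successorsM X) <= successors_time t w.
Proof.
move=> clX; have le := card_eligible_le clX.
rewrite 2!steps_bind result_eligibleM addnA; apply: leq_add.
  by apply: leq_add; [apply: steps_eligibleM|rewrite steps_nonempty_subsetsM -?cardE].
apply: leq_trans (steps_mapM (k := t) _) _; first by move=> D _; rewrite stepsE.
rewrite leq_mul2r (leq_trans (size_nonempty_subsetsM _)) ?orbT //.
by rewrite leq_pexp2l // -cardE.
Qed.

Lemma size_nodes ns : nodes_inv ns -> size ns <= N.
Proof.
by move=> nsI; apply: leq_trans (nodes_inv_size nsI) _; rewrite leq_pexp2l.
Qed.

Lemma steps_memM X ns : size ns <= N -> steps (memM X ns) <= N * t.+1.
Proof.
move=> le; apply: leq_trans (steps_hasM (k := t) _) _; first by move=> Y _; rewrite stepsE.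
by rewrite leq_mul2r le orbT.
Qed.

Lemma steps_passM ns : nodes_inv ns -> steps (passM ns) <= pass_time t w N.
Proof.
move=> nsI; have szns := size_nodes nsI; rewrite stepsE.
have [szf stf] := flatmapM_bounds (f := @successorsM F I) (s := ns)
  (k := successors_time t w) (l := 2 ^ w)
  (fun X Xns => conj (steps_successorsM (nsI.2 X Xns)) (size_successorsM_le (nsI.2 X Xns))).
apply: leq_add; first by apply: leq_trans stf _; rewrite leq_mul2r szns orbT.
set new := result _ in szf *.
have [|_ st] := @foldM_ind _ _ (@nodes_inv F I) (@insertM F I) ns new (N * t.+1) nsI.
  move=> ns' Z; rewrite /new result_flatmapM => /hasP[X Xns ZX] ns'I; split.
    by apply: insertM_inv => //; apply: closed_successor ZX; apply: nsI.2.
  by rewrite !stepsE addn0 steps_memM // size_nodes.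
apply: leq_trans st _; rewrite leq_mul2r (leq_trans szf) ?orbT //.
by rewrite leq_mul2r szns orbT.
Qed.

Lemma steps_evolution_nodesM : steps (evolution_nodesM I) <= nodes_time t w N.
Proof.
rewrite !stepsE leq_add2l.
have [|_ st] := @foldM_ind _ _ (@nodes_inv F I) (fun ns (_ : task) => passM ns) [:: set0]
  (enum task) (pass_time t w N) (@nodes_inv0 _ I).
  by move=> ns j _ nsI; split; [apply: passM_inv | apply: steps_passM].
by apply: leq_trans st _; rewrite size_enum_ord.
Qed.

Lemma evolution_arcsM_bounds ns : nodes_inv ns ->
  size (result (evolution_arcsM ns)) <= N * 2 ^ w /\
  steps (evolution_arcsM ns) <= arcs_time t w N.
Proof.
move=> nsI; have szns := size_nodes nsI.
have [|sz st] := flatmapM_bounds (f := fun X =>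
    let! r := successorsM X in mapM (fun Z => ret (X, Z)) r) (s := ns)
  (k := successors_time t w + 2 ^ w) (l := 2 ^ w).
  move=> X /nsI.2 clX; have sz := size_successorsM_le clX.
  rewrite stepsE result_bind result_mapM size_map; split=> //.
  apply: leq_add; first exact: steps_successorsM.
  apply: leq_trans (steps_mapM (k := 0) _) _; last by rewrite muln1.
  by move=> Z _; rewrite stepsE.
by split; [apply: leq_trans sz _|apply: leq_trans st _]; rewrite leq_mul2r szns orbT.
Qed.

Lemma steps_toposortM fuel (arcs : seq ({set task} * {set task})) ns :
  fuel <= N -> size ns <= N -> size arcs <= N * 2 ^ w ->
  steps (toposortM fuel arcs ns)
  <= fuel * (N * (source_time t w N).+1 + N * t.+1 + 1).
Proof.
move=> + + szarcs; elim: fuel ns => [|fuel IH] ns // leN szns.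
have stsrc X : steps (remaining_sourceM arcs ns X) <= source_time t w N.
  rewrite !stepsE addn0; apply: leq_trans (steps_hasM (k := t + N * t.+1) _) _.
    by move=> a _; rewrite !stepsE addn0 leq_add2l steps_memM.
  by rewrite leq_mul2r szarcs orbT.
rewrite toposortMS stepsE mulSn -!addnA; apply: leq_add.
  apply: leq_trans (steps_findM (k := source_time t w N) _) _; first by move=> X _.
  by rewrite leq_mul2r szns orbT.
case: (result (findM _ _)) => [X|]; last by rewrite stepsE.
rewrite !stepsE; apply: leq_add.
  apply: leq_trans (steps_filterM (k := t) _) _.
    by move=> Z _; rewrite !stepsE addn0.
  by rewrite leq_mul2r szns orbT.
rewrite [X in _ <= X]addnC leq_add2r !addnA; apply: IH; first exact: ltnW.
rewrite result_removeM size_filter; exact: leq_trans (count_size _ _) szns.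
Qed.

End EvolutionTime.

(** * Running time of the table computation *)

(* [lat K x] bounds the representation of [x] in terms of [K]. For rationals:
   [K x] is an integer and [|x| <= K]. The sums that OPT forms have a common
   denominator, which is why [K] is only doubled by an addition. *)
Record sizing (F : realFieldType) (cost : F -> F -> nat) (f : nat -> nat) := Sizing {
  lat :> nat -> F -> Prop;
  lat_gt0 : forall K x, lat K x -> (0 < K)%N;
  lat0 : lat 1 0;
  lat1 : lat 1 1;
  latW : forall K K' x, lat K x -> (K %| K')%N -> (0 < K')%N -> lat K' x;
  latD : forall K x y, lat K x -> lat K y -> lat (2 * K)%N (x + y);
  latB : forall K x y, lat K x -> lat K y -> lat (2 * K)%N (x - y);
  latM : forall K K' x y, lat K x -> lat K' y -> lat (K * K')%N (x * y);
  latV : forall K x, lat K x -> x != 0 -> exists2 m, (0 < m <= K ^ 3)%N & lat m x^-1;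
  lat_cost : forall b K K' x y, (K <= 2 ^ b)%N -> (K' <= 2 ^ b)%N ->
    lat K x -> lat K' y -> (cost x y <= f b)%N
}.

Section TableTime.
Local Open Scope nat_scope.

Definition assignments_time w n := 1 + n * (w.+1 ^ n * (w * 2 + w).+2).
Definition all_fail_time n c := n * (1 + c + c).+1.
Definition task_fail_time n c := n * (2 + c + c).+1.
Definition exactly_time w n c := w * (task_fail_time n c + 1 + c + c).+1.
Definition evaluate_time t w n N c :=
  all_fail_time n c + c + c + w * (n * 2).+1 + subsets_time t w
  + 2 ^ w * (exactly_time w n c + t + N * t.+1 + c + c).+1 + c.
Definition entry_time t w n N c :=
  eligible_time t + assignments_time w n + w.+1 ^ n * (evaluate_time t w n N c + c).+1.

(** Sizes in terms of the size [Q] of the probabilities: a product of at most [n] factors [1 - p],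
    each of size [2 * Q], and for [gap_size] one more subtraction from 1. *)
Definition fail_size Q n := (2 * Q) ^ n.
Definition gap_size Q n := 2 * fail_size Q n.
(** The factor by which one entry may increase the common size of the table: at most [2 ^ w]
    additions each double it, the product over at most [w] assigned tasks costs [gap_size Q n ^ w],
    and inverting [1 - a] costs a cube. *)
Definition growth Q w n := 2 ^ 2 ^ w * (gap_size Q n ^ w * gap_size Q n ^ 3).

Context {F : realFieldType} (cost : F -> F -> nat) (f : nat -> nat) (L : sizing cost f).
Context (I : ropas F) (w n : nat) (width_le : width I <= w) (workers_le : nworkers I <= n).
Local Notation task := 'I_(ntasks I).
Local Notation worker := 'I_(nworkers I).
Local Notation t := (ntasks I).
Local Notation N := (t.+1 ^ w).
Context (Q : nat) (Q_gt0 : 0 < Q) (prob_lat : forall i j, L Q (@prob F I i j)).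
Implicit Types (X Y Z D : {set task}) (A : seq (worker * task)) (U E : seq task).
Implicit Types (table : seq (entry I)).
Local Notation Kf := (fail_size Q n).
Local Notation Kd := (gap_size Q n).
Local Notation M := (growth Q w n).

Lemma fail_size_gt0 : 0 < Kf. Proof. by rewrite expn_gt0 muln_gt0 Q_gt0. Qed.

Lemma gap_size_gt0 : 0 < Kd. Proof. by rewrite muln_gt0 fail_size_gt0. Qed.

Lemma growth_gt0 : 0 < M.
Proof.
rewrite /growth; move: (gap_size Q n) gap_size_gt0 => K K0.
by rewrite !muln_gt0 !expn_gt0 K0.
Qed.

Lemma lat_one_sub K x : L K x -> L (2 * K) (1 - x)%R.
Proof.
move=> Kx; apply: latB => //; apply: latW (lat1 L) _ (lat_gt0 Kx).
exact: dvd1n.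
Qed.

Lemma gap_le_growth i : i <= w -> Kd ^ i <= M /\ Kd ^ i * Kd ^ 3 <= M.
Proof.
move=> iw.
have le : Kd ^ i <= Kd ^ w by rewrite leq_pexp2l // gap_size_gt0.
have k0 : 0 < Kd ^ i by rewrite expn_gt0 gap_size_gt0.
have k3 : 0 < Kd ^ 3 by rewrite expn_gt0 gap_size_gt0.
have k2 : 0 < 2 ^ 2 ^ w by rewrite expn_gt0.
suff H : Kd ^ i * Kd ^ 3 <= M by split=> //; apply: leq_trans H; rewrite leq_pmulr.
by apply: leq_trans (leq_pmull _ k2); rewrite leq_mul2r le orbT.
Qed.

Lemma gap_le_growth1 : Kd <= M.
Proof.
have [_] := gap_le_growth (leq0n w); apply: leq_trans.
by rewrite mul1n -[X in X <= _]expn1 leq_pexp2l // gap_size_gt0.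
Qed.

Lemma fail_pow_le i : i <= n -> (2 * Q) ^ i <= Kd.
Proof.
move=> le; apply: leq_trans (leq_pmull _ (isT : 0 < 2)).
by rewrite leq_pexp2l // muln_gt0 Q_gt0.
Qed.

Lemma prob_le_gap : 0 < n -> 2 * Q <= Kd.
Proof. by move=> n0; rewrite -[X in X <= _]expn1 fail_pow_le. Qed.

Section Entry.
Context (C b : nat) (C_gt0 : 0 < C) (CM_le : C * M <= 2 ^ b).
Local Notation c := (f b).

(** All operands in the computation of an entry have size at most [C * M], so one cost [f b] serves
    for every operation. *)
Lemma cost_le K K' x y : L K x -> L K' y -> K <= C * M -> K' <= C * M -> cost x y <= c.
Proof.
move=> Kx K'y le le'.
by apply: (lat_cost _ _ Kx K'y); [apply: leq_trans le CM_le|apply: leq_trans le' CM_le].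
Qed.

Lemma leC K : K <= M -> K <= C * M.
Proof. by move=> le; apply: leq_trans le (leq_pmull _ C_gt0). Qed.

Lemma leGap K : K <= Kd -> K <= C * M.
Proof. by move=> le; apply/leC/(leq_trans le)/gap_le_growth1. Qed.

Lemma all_failM_bounds A : size A <= n ->
  L Kf (result (all_failM cost A)) /\ steps (all_failM cost A) <= all_fail_time n c.
Proof.
move=> szA.
have [||la st] := @foldM_inv _ _ (fun i acc => L ((2 * Q) ^ i) acc)
  (fun acc (ij : worker * task) => let! p := probM ij.1 ij.2 in
    let! q := subM cost 1 p in mulM cost acc q) 1%R A (1 + c + c) 0.
- exact: lat1.
- move=> i acc ij /andP[_ iA] _ lacc; have lp := prob_lat ij.1 ij.2.
  have lq := lat_one_sub lp; have n0 : 0 < n by apply: leq_trans szA; apply: leq_ltn_trans iA.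
  split; first by rewrite expnSr; apply: latM.
  rewrite !stepsE -addnA leq_add2l; apply: leq_add.
    apply: (cost_le (lat1 L) lp); first exact: leC growth_gt0.
    by apply: leGap; apply: leq_trans (prob_le_gap n0); rewrite leq_pmull.
  apply: (cost_le lacc lq); last by apply/leGap/prob_le_gap.
  by apply/leGap/fail_pow_le/ltnW/(leq_trans iA).
split; last by apply: leq_trans st _; rewrite leq_mul2r szA orbT.
by apply: latW la _ fail_size_gt0; apply: dvdn_exp2l.
Qed.

Lemma task_failM_bounds A j : size A <= n ->
  L Kf (result (task_failM cost A j)) /\ steps (task_failM cost A j) <= task_fail_time n c.
Proof.
move=> szA.
have [||la st] := @foldM_inv _ _ (fun i acc => L ((2 * Q) ^ i) acc)
  (fun acc (ij : worker * task) => let! b := charge 1 (ij.2 == j) in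
    if b then let! p := probM ij.1 ij.2 in
      let! q := subM cost 1 p in mulM cost acc q else ret acc) 1%R A (2 + c + c) 0.
- exact: lat1.
- move=> i acc ij /andP[_ iA] _ lacc; have lp := prob_lat ij.1 ij.2.
  have lq := lat_one_sub lp; have n0 : 0 < n by apply: leq_trans szA; apply: leq_ltn_trans iA.
  rewrite result_bind steps_bind; case: ifP => _; last first.
    split; last by rewrite !stepsE.
    apply: latW lacc _ _; last by rewrite expn_gt0 muln_gt0 Q_gt0.
    by apply: dvdn_exp2l.
  split; first by rewrite expnSr; apply: latM.
  rewrite !stepsE addnA -addnA leq_add2l; apply: leq_add.
    apply: (cost_le (lat1 L) lp); first exact: leC growth_gt0.
    by apply: leGap; apply: leq_trans (prob_le_gap n0); rewrite leq_pmull.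
  apply: (cost_le lacc lq); last by apply/leGap/prob_le_gap.
  by apply/leGap/fail_pow_le/ltnW/(leq_trans iA).
split; last by apply: leq_trans st _; rewrite leq_mul2r szA orbT.
by apply: latW la _ fail_size_gt0; apply: dvdn_exp2l.
Qed.

Lemma exactlyM_bounds A U D : size A <= n -> size U <= w ->
  L (Kd ^ w) (result (exactlyM cost A U D)) /\
  steps (exactlyM cost A U D) <= exactly_time w n c.
Proof.
move=> szA szU.
have [||la st] := @foldM_inv _ _ (fun i acc => L (Kd ^ i) acc)
  (fun acc j => let! f := task_failM cost A j in let! jD := in_setM j D in
    if jD then let! s := subM cost 1 f in mulM cost acc s
    else mulM cost acc f) 1%R U (task_fail_time n c + 1 + c + c) 0.
- exact: lat1.
- move=> i acc j /andP[_ iU] _ lacc; have [lf stf] := task_failM_bounds j szA.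
  have ls := lat_one_sub lf.
  have lf' : L Kd (result (task_failM cost A j)).
    by apply: latW lf _ gap_size_gt0; apply: dvdn_mull.
  have accM : Kd ^ i <= C * M by apply/leC/(proj1 (gap_le_growth _))/ltnW/(leq_trans iU).
  rewrite 2!result_bind 2!steps_bind -!addnA; case: ifP => _; split.
  + by rewrite expnSr; apply: latM.
  + apply: leq_add => //; rewrite !stepsE leq_add2l; apply: leq_add.
      apply: (cost_le (lat1 L) lf); first exact: leC growth_gt0.
      exact/leGap/fail_pow_le.
    exact: cost_le lacc ls accM (leGap _).
  + by rewrite expnSr; apply: latM.
  apply: leq_add => //; rewrite !stepsE leq_add2l; apply: leq_trans (leq_addr _ _).
  exact: cost_le lacc lf' accM (leGap _).
split; last by apply: leq_trans st _; rewrite leq_mul2r szU orbT.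
apply: latW la _ _; first exact: dvdn_exp2l.
by rewrite expn_gt0 gap_size_gt0.
Qed.

(** A single [C] for all entries: sums of products with entries then only pay a factor 2 per
    addition, instead of the product of the sizes of the summands. *)
Definition table_lat table := forall e, e \in table -> L C e.2.1.

Lemma lookupM_bounds table X : size table <= N -> table_lat table ->
  L C (result (lookupM table X)) /\ steps (lookupM table X) <= N * t.+1.
Proof.
move=> szt lt; rewrite !stepsE addn0; split; last first.
  apply: leq_trans (steps_findM (k := t) _) _; first by move=> e _; rewrite stepsE.
  by rewrite leq_mul2r szt orbT.
rewrite result_bind result_findM; case E: [seq _ <- _ | _] => [|e r] /=.
  by apply: latW (lat0 L) _ C_gt0; apply: dvd1n.
apply: lt; have : e \in [seq e <- table | result (eq_setM e.1 X)] by rewrite E mem_head.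
by rewrite mem_filter => /andP[].
Qed.

Lemma evaluateM_bounds table Y E A :
  size table <= N -> table_lat table -> size A <= n -> size E <= w ->
  (forall v, result (evaluateM cost table Y E A) = Some v ->
     exists2 m, 0 < m <= M & L (C * m) v) /\
  steps (evaluateM cost table Y E A) <= evaluate_time t w n N c.
Proof.
move=> szt lt szA szE; have [la sta] := all_failM_bounds szA.
have ld := lat_one_sub la; rewrite -/Kd in ld.
have cle0 K x : L K x -> K <= C * M -> forall y, L 1 y -> cost y x <= c /\ cost x y <= c.
  move=> Kx KM y ly.
  by split; [apply: cost_le ly Kx _ _|apply: cost_le Kx ly _ _] => //; apply: leC growth_gt0.
set U := result (assigned_tasksM E A).
have szU : size U <= w.
  by rewrite /U result_assigned_tasksM size_filter (leq_trans (count_size _ _)).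
have stU : steps (assigned_tasksM E A) <= w * (n * 2).+1.
  apply: leq_trans (steps_filterM (k := n * 2) _) _; last by rewrite leq_mul2r szE orbT.
  move=> j _; apply: leq_trans (steps_hasM (k := 1) _) _; last by rewrite leq_mul2r szA orbT.
  by move=> ij _; rewrite stepsE.
have szD : size (result (nonempty_subsetsM U)) <= 2 ^ w.
  by apply: leq_trans (size_nonempty_subsetsM _) _; rewrite leq_pexp2l.
have KdC0 : 0 < Kd ^ w * C by rewrite muln_gt0 expn_gt0 gap_size_gt0.
have leS i : i <= 2 ^ w -> 2 ^ i * (Kd ^ w * C) <= C * M.
  move=> iw; rewrite mulnA [X in X <= _]mulnC leq_mul2l; apply/orP; right.
  rewrite /growth; apply: leq_mul; first by rewrite leq_pexp2l.
  by rewrite leq_pmulr // expn_gt0 gap_size_gt0.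
(* Every summand has size [Kd ^ w * C], so after [i] terms the partial sum has size [2 ^ i] times
   that. *)
have [||ls sts] := @foldM_inv _ _ (fun i acc => L (2 ^ i * (Kd ^ w * C)) acc)
  (fun acc D => let! aD := exactlyM cost A U D in let! Z := unionM Y D in
    let! SZ := lookupM table Z in let! x := mulM cost aD SZ in addM cost acc x) 1%R
  (result (nonempty_subsetsM U)) (exactly_time w n c + t + N * t.+1 + c + c) 0.
- by rewrite mul1n; apply: latW (lat1 L) _ _ => //; apply: dvd1n.
- move=> i acc D /andP[_ iD] _ lacc.
  have [laD staD] := exactlyM_bounds D szA szU.
  have [lZ stZ] := lookupM_bounds (Y :|: D) szt lt.
  have lx := latM laD lZ; have iw : i < 2 ^ w by apply: leq_trans szD.
  rewrite 4!result_bind 4!steps_bind; split.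
    rewrite expnS -mulnA; apply: latD => //.
    by apply: latW lx _ _; [apply: dvdn_mull|rewrite muln_gt0 KdC0 expn_gt0].
  apply: (@leq_trans (exactly_time w n c + (t + (N * t.+1 + (c + c))))); last first.
    by rewrite !addnA.
  apply: leq_add => //; rewrite steps_charge leq_add2l; apply: leq_add => //; apply: leq_add.
    apply: (cost_le laD lZ); first by apply/leC/(proj1 (gap_le_growth _)).
    exact: leq_pmulr growth_gt0.
  apply: (cost_le lacc lx); first by apply/leS/ltnW.
  by rewrite -[X in X <= _]mul1n; apply: (leS 0).
set sum := foldM _ _ _ in ls sts.
have {}ls : L (2 ^ 2 ^ w * (Kd ^ w * C)) (result sum).
  apply: latW ls _ _; last by rewrite muln_gt0 KdC0 expn_gt0.
  by rewrite dvdn_mul // dvdn_exp2l.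
have {}sts : steps sum <= 2 ^ w * (exactly_time w n c + t + N * t.+1 + c + c).+1.
  by apply: leq_trans sts _; rewrite leq_mul2r szD orbT.
have [c1 _] := cle0 _ _ la (leGap (fail_pow_le (leqnn n))) _ (lat1 L).
have [_ c2] := cle0 _ _ ld (leGap (leqnn _)) _ (lat0 L).
have c3 : cost (result sum) (1 - result (all_failM cost A))%R <= c.
  exact: cost_le ls ld (leS _ (leqnn _)) (leGap (leqnn _)).
have le3 (x1 x2 x3 y : nat) : x1 <= all_fail_time n c -> x2 <= c -> x3 <= c ->
    y <= w * (n * 2).+1 + (subsets_time t w
      + (2 ^ w * (exactly_time w n c + t + N * t.+1 + c + c).+1 + c)) ->
    x1 + (x2 + (x3 + y)) <= evaluate_time t w n N c.
  by rewrite /evaluate_time; lia.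
rewrite /evaluateM 3!result_bind 3!steps_bind; case: ifPn => [_|d0].
  by split=> //; apply: le3.
rewrite 4!result_bind 4!steps_bind; split; last first.
  apply: le3 => //; apply: leq_add => //.
  apply: leq_add; first exact: steps_nonempty_subsetsM.
  by apply: leq_add => //; rewrite stepsE addn0.
move=> v /Some_inj <-; have [m /andP[m0 mle] lm] := latV ld d0.
(* The size of the quotient is kept as a multiple of [C], so that old entries can be raised to
   it. *)
exists (2 ^ 2 ^ w * (Kd ^ w * m)).
  rewrite !muln_gt0 m0 !expn_gt0 gap_size_gt0 /= /growth.
  by rewrite leq_mul2l; apply/orP; right; rewrite leq_mul2l mle orbT.
have -> : C * (2 ^ 2 ^ w * (Kd ^ w * m)) = 2 ^ 2 ^ w * (Kd ^ w * C) * m.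
  by move: (2 ^ 2 ^ w) (Kd ^ w) => a d; rewrite [d * C]mulnC !mulnA [a * C]mulnC.
exact: latM.
Qed.

Definition best_lat (best : option (F * seq (worker * task))) :=
  if best is Some vA then exists2 m, 0 < m <= M & L (C * m) vA.1 else True.

Lemma minimizeM_bounds table Y E As :
  size table <= N -> table_lat table -> size E <= w ->
  {in As, forall A, size A <= n} ->
  best_lat (result (minimizeM cost table Y E As)) /\
  steps (minimizeM cost table Y E As) <= size As * (evaluate_time t w n N c + c).+1.
Proof.
move=> szt lt szE szAs; apply: foldM_ind => // best A /szAs szA lbest.
have [lv stv] := evaluateM_bounds Y szt lt szA szE.
rewrite result_bind steps_bind; case: (result (evaluateM _ _ _ _ _)) lv => [x|] lv.
  have [m mle lx] := lv x erefl.
  case: best lbest => [[y B]|_]; last first.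
    by split; [exists m|rewrite stepsE addn0; apply: leq_trans stv (leq_addr _ _)].
  move=> [m' m'le ly]; rewrite result_bind steps_bind; split.
    by case: ifP => _; [exists m|exists m'].
  rewrite stepsE addn0; apply: leq_add => //; apply: (cost_le lx ly).
    by rewrite leq_mul2l; case/andP: mle => _ ->; rewrite orbT.
  by rewrite leq_mul2l; case/andP: m'le => _ ->; rewrite orbT.
by split=> //; rewrite stepsE addn0; apply: leq_trans stv (leq_addr _ _).
Qed.

End Entry.

Lemma assignmentsM_bounds (ws : seq worker) E : size E <= w -> size ws <= n ->
  size (result (assignmentsM ws E)) <= w.+1 ^ size ws /\
  steps (assignmentsM ws E) <= 1 + size ws * (w.+1 ^ n * (w * 2 + w).+2).
Proof.
move=> szE; elim: ws => [|i ws IH] // szws; have [sz st] := IH (ltnW szws).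
have [|sz' st'] := flatmapM_bounds (s := result (assignmentsM ws E)) (k := w * 2) (l := w)
    (f := fun A => mapM (fun j => charge 1 ((i, j) :: A)) E).
  move=> A _; rewrite result_mapM size_map; split=> //.
  apply: leq_trans (steps_mapM (k := 1) _) _; first by move=> j _; rewrite stepsE.
  by rewrite leq_mul2r szE orbT.
split.
  apply: leq_trans sz' _; rewrite expnSr; apply: leq_mul => //.
have le : size (result (assignmentsM ws E)) <= w.+1 ^ n.
  by apply: leq_trans sz _; rewrite leq_pexp2l // ltnW.
rewrite -[assignmentsM _ _]/(let! r := assignmentsM ws E in
  flatmapM (fun A => mapM (fun j => charge 1 ((i, j) :: A)) E) r) steps_bind.
rewrite mulSn addnCA addnC; apply: leq_add => //.
by apply: leq_trans st' _; rewrite leq_mul2r le orbT.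
Qed.

Lemma entryM_bounds C b table Y : 0 < C -> C * M <= 2 ^ b -> closed_set Y ->
  size table <= N -> table_lat C table ->
  (exists2 m, 0 < m <= M & L (C * m) (result (entryM cost table Y)).2.1) /\
  steps (entryM cost table Y) <= entry_time t w n N (f b).
Proof.
move=> C0 CM clY szt lt; have szE : size (enum (eligible Y)) <= w.
  by rewrite -cardE (card_eligible_le width_le).
have szw : size (enum worker) <= n by rewrite size_enum_ord.
have [szA stA] := assignmentsM_bounds szE szw.
have szA' : size (result (assignmentsM (enum worker) (enum (eligible Y)))) <= w.+1 ^ n.
  by apply: leq_trans szA _; rewrite leq_pexp2l.
have [|lb stb] := minimizeM_bounds C0 CM Y (As :=
    result (assignmentsM (enum worker) (enum (eligible Y)))) szt lt szE.
  by move=> A /valid_assignmentP[A1 _]; have := congr1 size A1; rewrite size_map => ->.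
rewrite !result_bind 3!steps_bind result_eligibleM; split.
  case: (result (minimizeM _ _ _ _ _)) lb => [vA//|_]; exists 1; first by rewrite growth_gt0.
  by apply: latW (lat0 L) _ _; rewrite ?muln1 ?dvd1n.
rewrite /entry_time -addnA; apply: leq_add; first exact: steps_eligibleM.
apply: leq_add.
  by apply: leq_trans stA _; rewrite leq_add2l leq_mul2r szw orbT.
by rewrite steps_ret addn0; apply: leq_trans stb _; rewrite leq_mul2r szA' orbT.
Qed.

(** Each entry multiplies [C] by some [m <= M], and since [C] divides [C * m] the older entries are
    also of the new size. The exponent [N.+1] leaves room for the factor [M] used while an entry is
    being computed. *)
Lemma tableM_bounds b (s : seq {set task}) : M ^ N.+1 <= 2 ^ b -> nodes_inv s ->
  [/\ size (result (tableM cost s)) = size s,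
      exists2 C, 0 < C <= M ^ size s & table_lat C (result (tableM cost s))
    & steps (tableM cost s) <= size s * (entry_time t w n N (f b)).+1].
Proof.
move=> MN; elim: s => [|Y [|Z s] IH] sI.
- by split=> //; exists 1.
- split=> //.
  exists 1; first by rewrite expn_gt0 growth_gt0.
  by move=> e; rewrite inE => /eqP->; apply: lat0.
have s'I : nodes_inv (Z :: s).
  by case: sI => /andP[_ us] cls; split=> // X Xs; apply: cls; rewrite inE Xs orbT.
have szs : size (Y :: Z :: s) <= N := size_nodes width_le sI.
set s' := Z :: s in IH s'I szs *; have [sz [C /andP[C0 CM] lt] st] := IH s'I.
set table := result (tableM cost s') in sz lt.
have -> : tableM cost (Y :: s') = let! table := tableM cost s' in
  let! e := entryM cost table Y in charge 1 (e :: table) by [].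
have CM2 : C * M <= 2 ^ b.
  apply: leq_trans MN; apply: (@leq_trans (M ^ (size s').+1)).
    by rewrite expnSr leq_mul2r CM orbT.
  by rewrite leq_pexp2l ?growth_gt0 // ltnS ltnW.
have [] := @entryM_bounds C b table Y C0 CM2 _ _ lt.
- by apply: sI.2; rewrite mem_head.
- by rewrite sz ltnW.
move=> [m /andP[m0 mM] lm] ste.
have -> : result (let! table := tableM cost s' in
  let! e := entryM cost table Y in charge 1 (e :: table))
  = result (entryM cost table Y) :: table by [].
split; first by rewrite /= sz.
  exists (C * m); first by rewrite muln_gt0 C0 m0 expnSr leq_mul.
  move=> e; rewrite inE => /orP[/eqP->//|/lt le].
  by apply: latW le _ _; rewrite ?dvdn_mulr ?muln_gt0 ?C0.
rewrite 2!steps_bind steps_charge addn1 mulSn [X in X <= _]addnC.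
by apply: leq_add => //; rewrite ltnS.
Qed.

Definition opt_time_bound t w n N c :=
  nodes_time t w N + (arcs_time t w N + (N + (toposort_time t w N
    + N * (entry_time t w n N c).+1))).

Lemma opt_time_le b : M ^ N.+1 <= 2 ^ b -> opt_time cost I <= opt_time_bound t w n N (f b).
Proof.
move=> MN; have nsI := evolution_nodesM_inv I; set ns := result (evolution_nodesM I) in nsI.
have szns : size ns <= N := size_nodes width_le nsI.
have [sza sta] := evolution_arcsM_bounds width_le nsI.
have oI : nodes_inv (opt_order I).
  by split; [apply: uniq_opt_order|move=> X; rewrite mem_opt_order].
have [_ _ stt] := tableM_bounds MN oI.
have -> : opt_time cost I = steps (evolution_nodesM I) + (steps (evolution_arcsM ns)
  + (size ns + (steps (toposortM (size ns) (result (evolution_arcsM ns)) ns)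
  + steps (tableM cost (opt_order I))))) by [].
apply: leq_add; first exact: steps_evolution_nodesM.
apply: leq_add => //; apply: leq_add => //; apply: leq_add.
  apply: leq_trans (steps_toposortM szns szns sza) _.
  by rewrite leq_mul2r szns orbT.
apply: leq_trans stt _; rewrite leq_mul2r (size_nodes width_le oI) orbT //.
Qed.

End TableTime.

(** * Sizes of the numbers *)

Section UnitSizing.
Context (F : realFieldType).

Definition unit_lat (K : nat) (x : F) : Prop := (0 < K)%N.

Lemma unit_latV K x : unit_lat K x -> x != 0 -> exists2 m, (0 < m <= K ^ 3)%N & unit_lat m x^-1.
Proof. by move=> K0 _; exists 1%N => //; rewrite expn_gt0 K0. Qed.

Definition unit_sizing : sizing (@unit_cost F) (fun=> 1%N).
Proof.
apply: (@Sizing _ _ _ unit_lat) => //.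
- by move=> K x y K0 _; rewrite /unit_lat muln_gt0.
- by move=> K x y K0 _; rewrite /unit_lat muln_gt0.
- by move=> K K' x y; rewrite /unit_lat muln_gt0 => -> ->.
- exact: unit_latV.
Defined.

End UnitSizing.

Section RatSizing.
Implicit Types (x y : rat) (K b : nat).

Definition rat_lat K x : Prop :=
  [/\ (0 < K)%N, K%:R * x \is a Num.int & `|x| <= K%:R].

Lemma rat_latW K K' x : rat_lat K x -> (K %| K')%N -> (0 < K')%N -> rat_lat K' x.
Proof.
move=> [K0 Kx le] KK' K'0; split=> //; last first.
  by apply: le_trans le _; rewrite ler_nat dvdn_leq.
by have /dvdnP[q ->] := KK'; rewrite natrM -mulrA rpredM ?natr_int.
Qed.

Lemma rat_latD K x y : rat_lat K x -> rat_lat K y -> rat_lat (2 * K) (x + y).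
Proof.
move=> [K0 Kx lex] [_ Ky ley]; split; first by rewrite muln_gt0.
  by rewrite natrM -mulrA mulrDr rpredM ?natr_int ?rpredD.
by apply: le_trans (ler_normD _ _) _; rewrite natrM mulr_natl mulr2n lerD.
Qed.

Lemma rat_latN K x : rat_lat K x -> rat_lat K (- x).
Proof. by case=> K0 Kx le; split; rewrite ?mulrN ?rpredN ?normrN. Qed.

Lemma rat_latM K K' x y : rat_lat K x -> rat_lat K' y -> rat_lat (K * K') (x * y).
Proof.
move=> [K0 Kx lex] [K'0 Ky ley]; split; first by rewrite muln_gt0 K0.
  by rewrite natrM mulrACA rpredM.
by rewrite normrM natrM ler_pM ?normr_ge0.
Qed.

(** Write [x = z / K] with an integer [z]. Then [|z| = K * |x|] is at most [K ^ 2] and is a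
    denominator of the inverse [K / z]; the further factor [K] makes [m = |z| * K] also bound its
    absolute value. *)
Lemma rat_latV K x : rat_lat K x -> x != 0 -> exists2 m, (0 < m <= K ^ 3)%N & rat_lat m x^-1.
Proof.
move=> [K0 /intrP[z Kx] le] x0.
have K0' : K%:R != 0 :> rat by rewrite pnatr_eq0 -lt0n.
have z0 : z != 0 by rewrite -(intr_eq0 rat) -Kx mulf_neq0.
have absz_gt0' : (0 < `|z|)%N by rewrite absz_gt0.
have zE : (`|z|%N%:R = K%:R * `|x| :> rat).
  by rewrite -[K%:R]ger0_norm ?ler0n // -normrM Kx natr_absz intr_norm.
exists (`|z| * K)%N.
  rewrite muln_gt0 absz_gt0' K0 /= expnSr leq_mul2r -(ler_nat rat) zE natrX expr2.
  by rewrite ler_pM2l ?ltr0n // le orbT.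
split; first by rewrite muln_gt0 absz_gt0'.
  have -> : (`|z| * K)%:R * x^-1 = K%:R * K%:R * (`|x| / x) :> rat.
    by rewrite natrM zE; ring.
  apply: rpredM; first by rewrite rpredM ?natr_int.
  have [hx|hx] := leP 0 x.
    by rewrite ger0_norm // divff ?rpred1.
  by rewrite ltr0_norm // mulNr divff ?rpredN ?rpred1.
rewrite normfV -[X in X <= _]mul1r ler_pdivrMr ?normr_gt0 //.
by rewrite natrM -mulrA -zE -natrM ler1n muln_gt0 absz_gt0'.
Qed.

Lemma nat_bits_le a e : (a <= 2 ^ e)%N -> (nat_bits a <= e.+1)%N.
Proof. by move=> /(leq_trunc_log 2); rewrite trunc_expnK. Qed.

(** From [K * numq x = z * denq x] and coprimality, the reduced denominator divides [K]. *)
Lemma rat_lat_den K x : rat_lat K x -> (`|denq x| <= K)%N.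
Proof.
move=> [K0 /intrP[z Kx] _].
have : (K%:Z * numq x = z * denq x)%R.
  apply: (@intr_inj rat); rewrite !rmorphM /= -Kx numqE -mulrA; congr (_ * _).
move=> E; have : (denq x %| K%:Z * numq x)%Z by rewrite E dvdz_mull.
rewrite Gauss_dvdzl; last first.
  by rewrite /coprimez /gcdz eqz_nat -/(coprime _ _) coprime_sym coprime_num_den.
by rewrite dvdzE /= => /dvdn_leq; apply.
Qed.

Lemma rat_lat_num K x : rat_lat K x -> (`|numq x| <= K * K)%N.
Proof.
move=> lx; have den := rat_lat_den lx; case: lx => K0 _ le.
rewrite -(ler_nat rat) natr_absz intr_norm numqE normrM natrM ler_pM ?normr_ge0 //.
by rewrite -intr_norm -natr_absz ler_nat.
Qed.

(** At most [b + 1] bits for the denominator, [2 * b + 1] for the numerator, and one for the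
    sign. *)
Lemma rat_bits_le b K x : (K <= 2 ^ b)%N -> rat_lat K x -> (rat_bits x <= 3 * b + 3)%N.
Proof.
move=> Kb lx.
have := nat_bits_le (leq_trans (rat_lat_den lx) Kb).
have := @nat_bits_le `|numq x|%N (b + b) _.
move=> /(_ (leq_trans (rat_lat_num lx) _)); rewrite expnD leq_mul // => /(_ isT).
by rewrite /rat_bits; lia.
Qed.

(** [6 * b + 6] bounds the total length of two operands. The definition is transparent so that its
    [lat] reduces to [rat_lat] when [rat_prob_lat] is supplied. *)
Definition rat_sizing : sizing bit_cost (fun b => (6 * b + 6) ^ 2)%N.
Proof.
apply: (@Sizing _ _ _ rat_lat).
- by move=> K x [].
- by split; rewrite ?mulr0 ?rpred0 ?normr0.
- by split; rewrite ?mulr1 ?rpred1 ?normr1.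
- exact: rat_latW.
- exact: rat_latD.
- by move=> K x y lx /rat_latN; apply: rat_latD.
- exact: rat_latM.
- exact: rat_latV.
- move=> b K K' x y Kb K'b lx ly; rewrite /bit_cost leq_exp2r //.
  by have := rat_bits_le Kb lx; have := rat_bits_le K'b ly; lia.
Defined.

End RatSizing.

(** * Polynomial bounds *)

Section PolyBounded.
Context {T : Type} (good : T -> Prop) (sz : T -> nat).
Implicit Types (g h : T -> nat).
Local Open Scope nat_scope.

(** The base [(sz x).+1] is positive, so the bound is monotone in the exponent also at size 0, which
    closure under sums relies on. *)
Definition poly_bounded g :=
  exists c d, forall x, good x -> g x <= c * (sz x).+1 ^ d.

Lemma poly_bounded_le g h : (forall x, good x -> g x <= h x) ->
  poly_bounded h -> poly_bounded g.
Proof.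
by move=> gh [c [d H]]; exists c, d => x gx; apply: leq_trans (gh x gx) (H x gx).
Qed.

Lemma poly_bounded_cst k : poly_bounded (fun=> k).
Proof. by exists k, 0 => x _; rewrite muln1. Qed.

Lemma poly_bounded_size : poly_bounded sz.
Proof. by exists 1, 1 => x _; rewrite mul1n. Qed.

Lemma poly_boundedD g h : poly_bounded g -> poly_bounded h ->
  poly_bounded (fun x => g x + h x).
Proof.
move=> [c [d H]] [c' [d' H']]; exists (c + c'), (d + d') => x gx.
have p k l : (sz x).+1 ^ k <= (sz x).+1 ^ (k + l) by rewrite leq_pexp2l // leq_addr.
rewrite mulnDl leq_add //.
  by apply: leq_trans (H x gx) _; rewrite leq_mul2l p orbT.
by apply: leq_trans (H' x gx) _; rewrite leq_mul2l addnC p orbT.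
Qed.

Lemma poly_boundedM g h : poly_bounded g -> poly_bounded h ->
  poly_bounded (fun x => g x * h x).
Proof.
move=> [c [d H]] [c' [d' H']]; exists (c * c'), (d + d') => x gx.
by rewrite expnD mulnACA leq_mul ?H ?H'.
Qed.

Lemma poly_boundedS g : poly_bounded g -> poly_bounded (fun x => (g x).+1).
Proof. exact: poly_boundedD (poly_bounded_cst 1). Qed.

Lemma poly_boundedX g k : poly_bounded g -> poly_bounded (fun x => g x ^ k).
Proof.
move=> pg; elim: k => [|k IH]; first exact: poly_bounded_cst.
by apply: (poly_bounded_le (h := fun x => g x * g x ^ k)) (poly_boundedM pg IH) => x _;
  rewrite expnS.
Qed.

(** For size [s > 0], [s + 1 <= 2 * s] gives the factor [2 ^ d]; size 0 is absorbed by the additive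
    constant. *)
Lemma poly_bounded_affine g : poly_bounded g ->
  exists c d, forall x, good x -> g x <= c * sz x ^ d + c.
Proof.
move=> [c [d H]]; exists (c * 2 ^ d), d => x gx; apply: leq_trans (H x gx) _.
case: (sz x) => [|s].
  by rewrite exp1n muln1; apply: leq_trans (leq_addl _ _); rewrite leq_pmulr // expn_gt0.
apply: leq_trans (leq_addr _ _); rewrite -mulnA leq_mul2l -expnMn; apply/orP; right.
by have [->//|d0] := posnP d; rewrite leq_exp2r //; lia.
Qed.

End PolyBounded.

Lemma leq_ntasks_input_size (F : realFieldType) (bits : F -> nat) (I : ropas F) :
  (ntasks I <= input_size bits I)%N.
Proof. by apply: leq_trans (leq_addr _ _); case: (ntasks I) => // t; rewrite leq_pmulr. Qed.

Section PolynomialTime.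
Context (F : realFieldType) (cost : F -> F -> nat) (bits : F -> nat) (f : nat -> nat).
Context (L : sizing cost f) (cf df : nat) (f_le : forall b, (f b <= cf * b.+1 ^ df)%N).
Context (prob_lat : forall I : ropas F, exists2 Q, (0 < Q <= 2 ^ input_size bits I)%N
  & forall i j, L Q (@prob F I i j)).
Local Open Scope nat_scope.

(** The binary logarithm of [growth Q w n] at [Q = 2 ^ l]. *)
Definition growth_bits w n l := 2 ^ w + (1 + n * (1 + l)) * (w + 3).

Lemma growth_le Q w n l : Q <= 2 ^ l -> growth Q w n <= 2 ^ growth_bits w n l.
Proof.
move=> Ql; have gap : gap_size Q n <= 2 ^ (1 + n * (1 + l)).
  rewrite /gap_size /fail_size expnD expn1 [n * _]mulnC expnM leq_mul2l /=.
  have [->//|n0] := posnP n; rewrite leq_exp2r //.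
  by rewrite expnD expn1 leq_mul2l.
rewrite /growth /growth_bits expnD leq_mul2l; apply/orP; right.
by rewrite -expnD expnM addnS leq_exp2r.
Qed.

Lemma sizing_polynomial_time : opt_polynomial_time cost bits.
Proof.
move=> w n; pose good (I : ropas F) := width I <= w /\ nworkers I <= n.
pose sz := input_size bits.
pose N (I : ropas F) := (ntasks I).+1 ^ w.
(* An exponent of 2 that dominates the power [N.+1] of [growth], as [opt_time_le] requires; it is
   polynomial because [N] is. *)
pose b I := growth_bits w n (sz I) * (N I).+1.
have pt : poly_bounded good sz (@ntasks F).
  by apply: poly_bounded_le (poly_bounded_size _ _) => I _; apply: leq_ntasks_input_size.
have pN : poly_bounded good sz N by apply/poly_boundedX/poly_boundedS.
have pl := poly_bounded_size good sz.
have pb : poly_bounded good sz b.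
  apply: poly_boundedM (poly_boundedS pN); rewrite /growth_bits.
  apply: poly_boundedD; first exact: poly_bounded_cst.
  apply: poly_boundedM; last exact: poly_bounded_cst.
  apply: poly_boundedS; apply: poly_boundedM; first exact: poly_bounded_cst.
  exact: poly_boundedS.
have pc : poly_bounded good sz (fun I => f (b I)).
  apply: (poly_bounded_le (h := fun I => cf * (b I).+1 ^ df)) => [I _|]; first exact: f_le.
  apply: poly_boundedM; first exact: poly_bounded_cst.
  exact/poly_boundedX/poly_boundedS.
suff [c [d H]] : exists c d, forall I, good I -> opt_time cost I <= c * sz I ^ d + c.
  by exists c, d => I wI nI; apply: H.
apply: poly_bounded_affine.
apply: (poly_bounded_le (h := fun I => opt_time_bound (ntasks I) w n (N I) (f (b I)))).
  move=> I [wI nI]; have [Q /andP[Q0 Ql] pQ] := prob_lat I.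
  apply: (opt_time_le wI nI Q0 pQ); rewrite /b expnM leq_exp2r //.
  exact: growth_le.
rewrite /opt_time_bound /nodes_time /arcs_time /toposort_time /entry_time /pass_time.
rewrite /source_time /successors_time /evaluate_time /exactly_time /task_fail_time.
rewrite /all_fail_time /subsets_time /assignments_time /eligible_time.
by repeat first [exact: poly_bounded_cst | exact: pt | exact: pN | exact: pc
  | apply: poly_boundedS | apply: poly_boundedD | apply: poly_boundedM].
Qed.

End PolynomialTime.

Lemma unit_polynomial_time (F : realFieldType) :
  opt_polynomial_time (@unit_cost F) (@unit_bits F).
Proof.
apply: (@sizing_polynomial_time F _ _ _ (unit_sizing F) 1 0) => // I.
by exists 1%N => [|i j]; rewrite ?expn_gt0.
Qed.

(** The product of all denominators is a common size for the probabilities; as bit lengths bound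
    logarithms, which add up under products, it is at most 2 to the input size. *)
Lemma rat_prob_lat (I : ropas rat) : exists2 Q, (0 < Q <= 2 ^ input_size rat_bits I)%N
  & forall i j, rat_lat Q (@prob _ I i j).
Proof.
pose den i j := `|denq (@prob _ I i j)|%N.
have den0 i j : (0 < den i j)%N by rewrite absz_gt0 denq_neq0.
exists (\prod_i \prod_j den i j)%N.
  apply/andP; split; first by apply: prodn_gt0 => i; apply: prodn_gt0.
  apply: (@leq_trans (2 ^ (\sum_i \sum_j rat_bits (@prob _ I i j)))); last first.
    by rewrite leq_pexp2l // leq_addl.
  rewrite expn_sum; apply: leq_prod => i _; rewrite expn_sum; apply: leq_prod => j _.
  apply: leq_trans (ltnW (trunc_log_ltn _ (isT : 1 < 2)%N)) _.
  by rewrite leq_pexp2l // /rat_bits -addnA addnCA leq_addr.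
move=> i j; apply: (@rat_latW (den i j)).
- have /andP[p0 p1] := @prob_bounds _ I i j; split=> //; last first.
    by rewrite ger0_norm // (le_trans p1) // ler1n.
  apply/intrP; exists (numq (@prob _ I i j)).
  by rewrite numqE mulrC natr_absz gtr0_norm ?denq_gt0.
- by rewrite (bigD1 i) //= (bigD1 j) //= -mulnA dvdn_mulr.
- by apply: prodn_gt0 => k; apply: prodn_gt0.
Qed.

Lemma rat_polynomial_time : opt_polynomial_time bit_cost rat_bits.
Proof.
(* The constants come from [(6 * b + 6) ^ 2 = 36 * (b + 1) ^ 2]. *)
apply: (@sizing_polynomial_time _ _ _ _ rat_sizing 36 2 _ rat_prob_lat) => b.
by rewrite -[36%N]/(6 ^ 2)%N -expnMn leq_exp2r // mulnS addnC.
Qed.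

(** * Expected completion time *)

Section Transfer.
Context (F : realFieldType) (I : ropas rat).
Local Notation J := (ropas_ratr F I).

(** [ropas_ratr] keeps tasks, workers and arcs, so both instances have the same assignments and
    regimens by conversion; only the probabilities are transported. *)
Lemma outcome_prob_ratr (A : assignment I) w :
  outcome_prob (I := J) A w = ratr (outcome_prob A w).
Proof.
rewrite /outcome_prob rmorph_prod; apply: eq_bigr => i _; rewrite /success_prob.
case: (A i) => [j|] /=; first by case: ifP; rewrite ?rmorphB ?rmorph1.
by case: ifP; rewrite ?rmorphB ?rmorph1 ?rmorph0.
Qed.

Lemma expect_ratr (A : assignment I) (G : {set 'I_(ntasks I)} -> rat) :
  expect (I := J) A (fun D => ratr (G D)) = ratr (expect A G).
Proof.
by rewrite /expect rmorph_sum; apply: eq_bigr => w _; rewrite rmorphM outcome_prob_ratr.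
Qed.

Lemma exact_prob_ratr (A : assignment I) D :
  exact_prob (I := J) A D = ratr (exact_prob A D).
Proof. by rewrite /exact_prob rmorph_sum; apply: eq_bigr => w _; apply: outcome_prob_ratr. Qed.

Lemma bellman_ratr (V : {set 'I_(ntasks I)} -> rat) (S : regimen I) :
  bellman V S -> bellman (I := J) (fun Y => ratr (V Y)) S.
Proof.
move=> [VT V0 ST bel]; split=> //; first by rewrite VT rmorph0.
  by move=> Y clY; rewrite ler0q V0.
move=> Y clY YT; have [opt SE lt1 VY] := bel Y clY YT; split=> //.
- move=> B BE; rewrite (expect_ratr B (fun D => V (Y :|: D))) -(rmorph1 (@ratr F)).
  by rewrite -rmorphD ler_rat; apply: opt.
- by rewrite exact_prob_ratr -(rmorph1 (@ratr F)) ltr_rat.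
- rewrite (expect_ratr (S Y) (fun D => V (Y :|: D))) -(rmorph1 (@ratr F)).
  by rewrite -rmorphD -VY.
Qed.

End Transfer.

From mathcomp Require Import boolp ereal topology normedtype sequences.

(** * Expectations from tail probabilities *)

Section Expectation.
Context {R : realType}.
Implicit Types (u q : nat -> R).
Local Open Scope ereal_scope.

Lemma nneseries_le u (b : R) : (forall k, 0 <= u k)%R ->
  (forall n, \sum_(k < n) u k <= b)%R -> \sum_(0 <= k <oo) (u k)%:E <= b%:E.
Proof.
move=> u0 ub; apply: lime_le.
  by apply: is_cvg_nneseries => k _ _; rewrite lee_fin.
by apply: nearW => n; rewrite sumEFin lee_fin big_mkord.
Qed.

Lemma nneseries_ge u n : (forall k, 0 <= u k)%R ->
  (\sum_(k < n) u k)%:E <= \sum_(0 <= k <oo) (u k)%:E.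
Proof.
move=> u0; have <- : \sum_(0 <= k < n) (u k)%:E = (\sum_(k < n) u k)%:E.
  by rewrite sumEFin big_mkord.
by apply: nneseries_lim_ge => k _ _; rewrite lee_fin.
Qed.

Section Tail.
Context (c q : nat -> R).
Context (c0 : forall k, (0 <= c k)%R) (q0 : forall k, (0 <= q k)%R).
Context (c_head : c 0%N = (1 - q 0%N)%R) (c_tail : forall k, c k.+1 = (q k - q k.+1)%R).

Lemma sum_c n : (\sum_(k < n.+1) c k = 1 - q n)%R.
Proof.
elim: n => [|n IH]; first by rewrite big_ord1.
by rewrite big_ord_recr /= IH c_tail addrA subrK.
Qed.

(** Summation by parts. The boundary term [n%:R * q n] is what both estimates of the expectation
    have to control. *)
Lemma sum_kc n : (\sum_(k < n.+1) k%:R * c k = \sum_(k < n) q k - n%:R * q n)%R.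
Proof.
elim: n => [|n IH]; first by rewrite big_ord1 big_ord0 !mul0r subr0.
by rewrite big_ord_recr /= IH c_tail big_ord_recr /=; ring.
Qed.

Lemma q_nonincreasing m n : (m <= n)%N -> (q n <= q m)%R.
Proof.
elim: n => [|n IH]; first by rewrite leqn0 => /eqP->.
rewrite leq_eqVlt => /orP[/eqP->//|]; rewrite ltnS => /IH; apply: le_trans.
by rewrite -subr_ge0 -c_tail.
Qed.

Lemma series_c_le1 : \sum_(0 <= k <oo) (c k)%:E <= 1.
Proof.
apply: nneseries_le => // -[|n]; first by rewrite big_ord0 ler01.
by rewrite sum_c gerDl oppr_le0.
Qed.

Lemma kc_ge0 k : (0 <= k%:R * c k)%R.
Proof. by rewrite mulr_ge0 ?ler0n. Qed.

Definition tail_expectation : \bar R :=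
  \sum_(0 <= k <oo) (k%:R * c k)%:E + +oo * (1 - \sum_(0 <= k <oo) (c k)%:E).

(** As [q] is nonincreasing, [n * q n] is at most the sum of its first [n] terms, hence at most [v].
    So [q] tends to 0, the probabilities [c] sum to 1 and the infinite summand vanishes. *)
Lemma tail_expectation_le (v : R) :
  (forall n, \sum_(k < n) q k <= v)%R -> tail_expectation <= v%:E.
Proof.
move=> qv; rewrite /tail_expectation.
have nq n : (n%:R * q n <= v)%R.
  apply: le_trans (qv n); rewrite mulr_natl -[n in (_ *+ n)%R]card_ord -sumr_const.
  by apply: ler_sum => k _; apply: q_nonincreasing; apply: ltnW.
have -> : \sum_(0 <= k <oo) (c k)%:E = 1.
  apply/eqP; rewrite eq_le series_c_le1 /=; apply/lee_addgt0Pr => e e0.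
  have v0 : (0 <= v)%R by apply: le_trans (qv 0%N); rewrite big_ord0.
  (* Any [n] above [v / e] gives [q n <= v / n <= e]. *)
  pose n := (Num.truncn (v / e)).+1.
  have qn : (q n <= e)%R.
    rewrite -(ler_pM2l (_ : 0 < n%:R)%R) ?ltr0n //; apply: le_trans (nq n) _.
    by rewrite -ler_pdivrMr // ltW // truncnS_gt.
  apply: le_trans (_ : (\sum_(k < n.+1) c k)%:E + e%:E <= _); last first.
    by rewrite leeD2r // nneseries_ge.
  by rewrite sum_c -EFinD lee_fin -subr_ge0; move: qn; lra.
rewrite subee // mule0 adde0; apply: nneseries_le; first exact: kc_ge0.
case=> [|n]; first by rewrite big_ord0; apply: le_trans (qv 0%N); rewrite big_ord0.
rewrite sum_kc; apply: le_trans (qv n); rewrite gerDl oppr_le0.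
by rewrite mulr_ge0 ?ler0n.
Qed.

(** If the probabilities sum to less than 1, the expectation is infinite. Otherwise [q] tends to 0,
    and the remainder [q n * M] can be made small. *)
Lemma tail_expectation_ge (v M : R) : (0 <= M)%R ->
  (forall n, v <= \sum_(k < n) q k + q n * M)%R -> v%:E <= tail_expectation.
Proof.
move=> M0 vq; rewrite /tail_expectation; set C := \sum_(0 <= k <oo) (c k)%:E.
have E0 : 0 <= \sum_(0 <= k <oo) (k%:R * c k)%:E.
  by apply: nneseries_ge0 => k _ _; rewrite lee_fin kc_ge0.
have [C1|C1] := ltP C 1.
  have -> : +oo * (1 - C) = +oo by rewrite gt0_mulye // sube_gt0.
  by rewrite addey ?leey // gt_eqF // (lt_le_trans _ E0) // ltNy0.
have CE : C = 1 by apply/eqP; rewrite eq_le series_c_le1.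
have small e : (0 < e)%R -> exists n, (q n < e)%R.
  move=> e0; apply: contrapT => nex.
  have qe n : (e <= q n)%R by rewrite leNgt; apply/negP => lt; apply: nex; exists n.
  have : C <= (1 - e)%:E.
    apply: nneseries_le => // -[|n].
      rewrite big_ord0 subr_ge0; apply: le_trans (qe 0%N) _.
      by rewrite -subr_ge0 -c_head.
    by rewrite sum_c lerD2l lerN2.
  by rewrite CE lee_fin lerDl oppr_ge0 leNgt e0.
rewrite CE subee // mule0 adde0; apply/lee_addgt0Pr => e e0.
(* [n] is fixed first, to make [q n * M] small, and only then [N0], to make [n%:R * q N] small for
   the boundary term. The added 1 avoids a zero denominator when [M] or [n] is 0. *)
have [n qn] := small (e / 2 / (M + 1))%R ltac:(by rewrite !divr_gt0 ?ltr_wpDl).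
have [N0 qN0] := small (e / 2 / (n%:R + 1))%R ltac:(by rewrite !divr_gt0 ?ltr_wpDl).
pose N := maxn n N0.
have qN : (q N < e / 2 / (n%:R + 1))%R.
  by apply: le_lt_trans qN0; rewrite q_nonincreasing // leq_maxr.
apply: le_trans (_ : (\sum_(k < N.+1) k%:R * c k)%:E + e%:E <= _); last first.
  by rewrite leeD2r // (nneseries_ge (u := fun k => k%:R * c k)%R) // => k; apply: kc_ge0.
rewrite -EFinD lee_fin.
(* The terms of [q] from [n] up to [N] are each at least [q N], so they pay for all but [n%:R * q N]
   of the boundary term [N%:R * q N]. *)
have lower : (\sum_(k < n) q k - n%:R * q N <= \sum_(k < N.+1) k%:R * c k)%R.
  rewrite sum_kc -(big_mkord xpredT q) -[in leRHS](big_mkord xpredT q).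
  rewrite (big_cat_nat (leq0n n) (leq_maxl n N0)) /= -addrA lerD2l -/N.
  rewrite lerBrDr -lerBrDl opprK.
  have -> : (N%:R = n%:R + (N - n)%:R :> R)%R by rewrite -natrD subnKC ?leq_maxl.
  rewrite mulrDl addrC lerD2r mulr_natl -sumr_const_nat.
  by apply: ler_sum_nat => k /andP[_ kN]; apply/q_nonincreasing/ltnW.
have m1 : (q n * M <= e / 2)%R.
  apply: le_trans (_ : e / 2 / (M + 1) * M <= _)%R; first by rewrite ler_wpM2r // ltW.
  rewrite -mulrA ler_piMr ?divr_ge0 ?ltW // mulrC ltr_pdivrMr ?ltr_wpDl //.
  by rewrite mul1r ltrDl.
have m2 : (n%:R * q N <= e / 2)%R.
  rewrite mulrC; apply: le_trans (_ : e / 2 / (n%:R + 1) * n%:R <= _)%R.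
    by rewrite ler_wpM2r ?ler0n // ltW.
  rewrite -mulrA ler_piMr ?divr_ge0 ?ltW // mulrC ltr_pdivrMr ?ltr_wpDl //.
  by rewrite mul1r ltrDl.
by move: (vq n); lra.
Qed.

End Tail.

Context (I : ropas R).

Lemma bellman_optimal (V : {set 'I_(ntasks I)} -> R) (S : regimen I) :
  bellman V S -> optimal I S.
Proof.
move=> bel; have regS := bellman_is_regimen bel; split=> // S' regS'.
apply: (@le_trans _ _ (V finset.set0)%:E).
  apply: (@tail_expectation_le _ (survival S)).
  - exact: completion_prob_ge0.
  - exact: survival_ge0.
  - exact: completion_prob0.
  - exact: completion_probS.
  - by move=> n; apply: bellman_upper.
apply: (@tail_expectation_ge _ (survival S') _ _ _ _ _ (value_bound V)).
- exact: completion_prob_ge0.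
- exact: survival_ge0.
- exact: completion_prob0.
- exact: completion_probS.
- exact: value_bound_ge0.
- by move=> n; apply: bellman_lower bel.
Qed.

End Expectation.

Theorem theorem3p7 (R : realType) :
  ((forall I : ropas R, optimal I (opt_regimen (@unit_cost R) I)) /\
   opt_polynomial_time (@unit_cost R) (@unit_bits R)) /\
  ((forall I : ropas rat,
      optimal (ropas_ratr R I) (opt_regimen bit_cost I)) /\
   opt_polynomial_time bit_cost rat_bits).
Proof.
split; split.
- by move=> I; apply: (bellman_optimal (@opt_bellman _ (@unit_cost R) I)).
- exact: unit_polynomial_time.
- by move=> I; apply: (bellman_optimal (bellman_ratr R (@opt_bellman _ bit_cost I))).
- exact: rat_polynomial_time.
Qed.
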